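(* Let $\mathbb{K}$ be a field and let $X=\bigoplus_{i=1}^{r}C_{n_i}$ be a finite direct sum of cyclic evolution algebras over $\mathbb{K}$, with $n_i\ge 1$. Then $[X]$ is a zero-divisor in the Grothendieck ring $\mathcal{G}$ of finite-dimensional non-degenerate evolution $\mathbb{K}$-algebras if and only if $n_i>1$ for every $i$; equivalently, if and only if every indecomposable direct summand of $X$ has balance greater than $1$.
   Context: An evolution algebra over $\mathbb{K}$ is a finite-dimensional (not necessarily associative) $\mathbb{K}$-algebra admitting a natural basis, i.e. a basis $\{e_1,\dots,e_n\}$ with $e_ie_j=0$ for $i\neq j$; it is non-degenerate if it has such a basis with all $e_i^2\ne0$. It is indecomposable if nonzero and not a direct sum of two nonzero ideals that are evolution algebras; every non-degenerate one decomposes uniquely as a direct sum of indecomposables. Non-degenerate evolution algebras are closed under $\oplus$ and $\otimes$ (over $\mathbb{K}$). The cyclic algebra is $C_n=\mathbb{K}c_0\oplus\dots\oplus\mathbb{K}c_{n-1}$ with $c_i^2=c_{i+1}$ (indices mod $n$) and $c_ic_j=0$ for $i\ne j$; $C_1=\mathbb{K}$. The Grothendieck ring $\mathcal{G}$ is the group completion of the commutative monoid of isomorphism classes $[X]$ of finite-dimensional non-degenerate evolution $\mathbb{K}$-algebras with $[X]+[Y]=[X\oplus Y]$, with multiplication $[X]\cdot[Y]=[X\otimes Y]$ and unit $[\mathbb{K}]$. An element $\alpha$ of a commutative ring is a zero-divisor if $\alpha\beta=0$ for some $\beta\neq0$ in the ring. Balance: if $e_i^2=\sum_k w_{ik}e_k$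 for a natural basis $B$ of $Y$, let $\Gamma(Y,B)$ be the directed graph on $\{1,\dots,n\}$ with an edge $(i,k)$ whenever $w_{ik}\neq0$. A path is a sequence $(v_0,e_1,v_1,\dots,e_n,v_n)$, $n\ge 0$, of vertices and edges where each $e_i$ is traversed either forwards ($e_i=(v_{i-1},v_i)$) or backwards ($e_i=(v_i,v_{i-1})$); its balance is the number of forward steps minus the number of backward steps (a loop may be traversed in either direction, contributing $+1$ or $-1$ accordingly). A cycle is a path with $v_0=v_n$. The balance of $Y$ is the gcd of the absolute values of the balances of all cycles of $\Gamma(Y,B)$ (independent of $B$ for nonzero non-degenerate $Y$). *)

(* Defs.v *)
From HB Require Import structures.
From mathcomp Require Import all_boot all_order all_algebra ring.
From mathcomp Require Import boolp classical_sets.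

Set Implicit Arguments.
Unset Strict Implicit.
Unset Printing Implicit Defensive.

Import GRing.Theory.
Local Open Scope ring_scope.
Local Open Scope quotient_scope.

Section Algebras.
Variable K : fieldType.

(* A finite-dimensional, not necessarily associative, K-algebra is given by a
   bilinear product on some K^n. Every finite-dimensional algebra is isomorphic
   to one of these, so the isomorphism classes are the same. *)
Record alg := Alg {
  adim : nat;
  amul :> {bilinear 'rV[K]_adim -> 'rV[K]_adim -> 'rV[K]_adim} }.

Definition alg_iso (A B : alg) : Prop :=
  exists2 f : {linear 'rV[K]_(adim A) -> 'rV[K]_(adim B)},
    bijective f & {morph f : x y / amul A x y >-> amul B x y}.

Section Subalgebras.
Variable A : alg.
Implicit Types U V W : {vspace 'rV[K]_(adim A)}.
Implicit Type b : seq 'rV[K]_(adim A).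

(* The predicates below concern subspaces U of A closed under the product;
   A itself is the case U = fullv. A basis has no repetition, so e_i e_j = 0
   for i <> j is the same as x y = 0 for distinct members x, y of b. *)
Definition natural_basis U b : Prop :=
  basis_of U b /\ {in b &, forall x y, x != y -> amul A x y = 0}.

Definition evolution U : Prop := exists b, natural_basis U b.

Definition nondegenerate U : Prop :=
  exists2 b, natural_basis U b & {in b, forall x, amul A x x != 0}.

Definition ideal_of U V : Prop :=
  (V <= U)%VS /\
  forall a x, a \in U -> x \in V -> amul A a x \in V /\ amul A x a \in V.

Definition evolution_decomposition U V W : Prop :=
  [/\ ideal_of U V, ideal_of U W, evolution V, evolution W
    & (V + W = U /\ V :&: W = 0)%VS].

Definition indecomposable U : Prop :=
  U <> 0%VS /\
  ~ exists V W, [/\ V <> 0%VS, W <> 0%VS & evolution_decomposition U V W].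

Definition direct_summand U : Prop :=
  exists V, evolution_decomposition fullv U V.

End Subalgebras.
End Algebras.

(* The divisibility-greatest common divisor of an arbitrary set of naturals;
   it is 0 for the empty set and for [set 0]. It always exists, see gcd_setP. *)
Definition is_gcd_set (S : set nat) (d : nat) : Prop :=
  (forall m, S m -> (d %| m)%N) /\
  (forall k, (forall m, S m -> (k %| m)%N) -> (k %| d)%N).

Definition gcd_set (S : set nat) : nat := xget 0%N [set d | is_gcd_set S d].

Lemma gcd_setP (S : set nat) : is_gcd_set S (gcd_set S).
Proof.
suff : exists d, is_gcd_set S d.
  by rewrite /gcd_set; case=> d hd; case: xgetP => [e _ //|/(_ d)].
have [S0|/existsNP[m0 /not_implyP[Sm0 /eqP]]] :=
    pselect (forall m, S m -> m = 0%N).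
  by exists 0%N; split=> [m /S0 ->|k _] //; rewrite dvdn0.
rewrite -lt0n => m0_gt0.
pose D := fun k : nat => `[< forall m, S m -> (k %| m)%N >].
exists (\big[lcmn/1%N]_(k < m0.+1 | D k) k); split=> [m Sm|k hk].
  by apply/dvdn_biglcmP => k /asboolP; apply.
have lt_k : (k < m0.+1)%N by rewrite ltnS dvdn_leq ?hk.
by apply: (biglcmn_sup (Ordinal lt_k)) => //; apply/asboolP.
Qed.

Section Balance.
Variables (n : nat) (E : rel 'I_n).

(* A step (true, w) from the vertex v traverses the edge (v, w) forwards, and
   a step (false, w) traverses the edge (w, v) backwards; a loop (v, v) can be
   traversed either way. A path is a starting vertex and a list of steps. *)
Fixpoint is_path (v : 'I_n) (s : seq (bool * 'I_n)) : Prop :=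
  if s is (fwd, w) :: s' then (if fwd then E v w else E w v) /\ is_path w s'
  else True.

Definition is_cycle (v : 'I_n) (s : seq (bool * 'I_n)) : Prop :=
  is_path v s /\ last v [seq x.2 | x <- s] = v.

Definition path_balance (s : seq (bool * 'I_n)) : int :=
  \sum_(x <- s) (if x.1 then 1 else -1).

Definition graph_balance : nat :=
  gcd_set [set m | exists v s, is_cycle v s /\ m = `|path_balance s|%N].

End Balance.

Section AlgBalance.
Variables (K : fieldType) (A : alg K).

Definition Gamma (b : seq 'rV[K]_(adim A)) : rel 'I_(size b) :=
  fun i k => coord (in_tuple b) k (amul A b`_i b`_i) != 0.

(* The balance of a nonzero non-degenerate evolution algebra does not depend on
   the natural basis; xget picks one, and the default vbasis U only matters
   when U is not an evolution algebra. *)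
Definition balance (U : {vspace 'rV[K]_(adim A)}) : nat :=
  graph_balance (@Gamma (xget (vbasis U : seq _) [set b | natural_basis U b])).

End AlgBalance.

Section LinearTools.
Variable K : fieldType.

Definition linear_pack (U V : lmodType K) (f : U -> V) (f_lin : linear f) :
  {linear U -> V} := HB.pack f (GRing.isLinear.Build K U V *:%R f f_lin).

Definition bilinear_pack (U U' V : lmodType K) (f : U -> U' -> V)
    (f_bil : bilinear_for *:%R *:%R f) : {bilinear U -> U' -> V} :=
  HB.pack f (bilinear_isBilinear.Build K U U' V *:%R *:%R f f_bil).

Lemma bilP (U U' V : lmodType K) (f : {bilinear U -> U' -> V}) :
  bilinear_for *:%R *:%R f.
Proof. by split=> u a x y; rewrite ?linearPl ?linearPr. Qed.

Lemma alg_isoI (A B : alg K) (f : 'rV[K]_(adim A) -> 'rV[K]_(adim B)) g :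
  linear f -> cancel f g -> cancel g f ->
  {morph f : x y / amul A x y >-> amul B x y} -> alg_iso A B.
Proof.
by move=> f_lin fK gK fM; exists (linear_pack f_lin) => //; exists g.
Qed.

Lemma alg_iso_inv (A B : alg K) : alg_iso A B ->
  exists f : {linear 'rV[K]_(adim A) -> 'rV[K]_(adim B)},
  exists g : {linear 'rV[K]_(adim B) -> 'rV[K]_(adim A)},
  [/\ cancel f g, cancel g f,
      {morph f : x y / amul A x y >-> amul B x y}
    & {morph g : x y / amul B x y >-> amul A x y}].
Proof.
case=> f [g fK gK] fM; have g_lin : linear g.
  by move=> a x y; apply: (can_inj fK); rewrite linearP !gK.
exists f, (linear_pack g_lin); split=> // x y /=.
by apply: (can_inj fK); rewrite fM !gK.
Qed.

Lemma alg_iso_refl (A : alg K) : alg_iso A A.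
Proof. by apply: (@alg_isoI A A id id). Qed.

Lemma alg_iso_sym (A B : alg K) : alg_iso A B -> alg_iso B A.
Proof.
case/alg_iso_inv=> f [g [fK gK fM gM]].
by exists g => //; exists f.
Qed.

Lemma alg_iso_trans (B A C : alg K) :
  alg_iso A B -> alg_iso B C -> alg_iso A C.
Proof.
case/alg_iso_inv=> f [f' [fK f'K fM _]] /alg_iso_inv[g [g' [gK g'K gM _]]].
apply: (@alg_isoI A C (g \o f) (f' \o g')).
- by move=> a x y /=; rewrite !linearP.
- exact: can_comp.
- exact: can_comp.
- by move=> x y /=; rewrite fM gM.
Qed.

End LinearTools.

Section DirectSum.
Variable K : fieldType.
Implicit Types A B C D : alg K.

Definition dsum_mul A B (x y : 'rV[K]_(adim A + adim B)) :=
  row_mx (amul A (lsubmx x) (lsubmx y)) (amul B (rsubmx x) (rsubmx y)).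

Lemma dsum_mul_bilinear A B : bilinear_for *:%R *:%R (@dsum_mul A B).
Proof.
by split=> u a x y; rewrite /dsum_mul !(linearPl, linearPr, linearP) /=
  ?(linearPl, linearPr, linearP) /= scale_row_mx add_row_mx.
Qed.

Definition dsum A B : alg K := Alg (bilinear_pack (dsum_mul_bilinear A B)).

Lemma dsum_mulE A B a a' b b' :
  amul (dsum A B) (row_mx a b) (row_mx a' b') =
  row_mx (amul A a a') (amul B b b').
Proof. by rewrite /= /dsum_mul !row_mxKl !row_mxKr. Qed.

Definition zero_mul (x y : 'rV[K]_0) : 'rV[K]_0 := 0.

Lemma zero_mul_bilinear : bilinear_for *:%R *:%R zero_mul.
Proof. by split=> u a x y; rewrite /zero_mul /= scaler0 addr0. Qed.

Definition zero_alg : alg K := Alg (bilinear_pack zero_mul_bilinear).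

Lemma dsum_isoC A B : alg_iso (dsum A B) (dsum B A).
Proof.
apply: (@alg_isoI _ (dsum A B) (dsum B A)
  (fun x : 'rV_(_ + _) => row_mx (rsubmx x) (lsubmx x))
  (fun x : 'rV_(_ + _) => row_mx (rsubmx x) (lsubmx x))).
- by move=> a x y; rewrite !linearP /= scale_row_mx add_row_mx.
- by move=> x; rewrite row_mxKl row_mxKr hsubmxK.
- by move=> x; rewrite row_mxKl row_mxKr hsubmxK.
- by move=> x y; rewrite dsum_mulE /= /dsum_mul row_mxKl row_mxKr.
Qed.

Lemma dsum_isoA A B C : alg_iso (dsum A (dsum B C)) (dsum (dsum A B) C).
Proof.
apply: (@alg_isoI _ (dsum A (dsum B C)) (dsum (dsum A B) C)
  (fun x : 'rV_(_ + (_ + _)) =>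
     row_mx (row_mx (lsubmx x) (lsubmx (rsubmx x))) (rsubmx (rsubmx x)))
  (fun x : 'rV_(_ + _ + _) =>
     row_mx (lsubmx (lsubmx x)) (row_mx (rsubmx (lsubmx x)) (rsubmx x)))).
- by move=> a x y; rewrite !linearP /= !(scale_row_mx, add_row_mx).
- by move=> x; rewrite !(row_mxKl, row_mxKr) !hsubmxK.
- by move=> x; rewrite !(row_mxKl, row_mxKr) !hsubmxK.
- by move=> x y; rewrite !dsum_mulE /= /dsum_mul /= /dsum_mul !(row_mxKl, row_mxKr).
Qed.

Lemma dsum_iso0 A : alg_iso (dsum zero_alg A) A.
Proof.
apply: (@alg_isoI _ (dsum zero_alg A) A
  (fun x : 'rV_(0 + _) => rsubmx x) (fun x => row_mx (0 : 'rV_0) x)).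
- by move=> a x y; rewrite linearP.
- by move=> x; rewrite -[RHS]hsubmxK [lsubmx x]thinmx0.
- by move=> x; rewrite row_mxKr.
- by move=> x y; rewrite /= /dsum_mul row_mxKr.
Qed.

Lemma dsum_iso A B C D :
  alg_iso A C -> alg_iso B D -> alg_iso (dsum A B) (dsum C D).
Proof.
case/alg_iso_inv=> f [f' [fK f'K fM _]] /alg_iso_inv[g [g' [gK g'K gM _]]].
apply: (@alg_isoI _ (dsum A B) (dsum C D)
  (fun x : 'rV_(_ + _) => row_mx (f (lsubmx x)) (g (rsubmx x)))
  (fun x : 'rV_(_ + _) => row_mx (f' (lsubmx x)) (g' (rsubmx x)))).
- by move=> a x y; rewrite !linearP /= scale_row_mx add_row_mx.
- by move=> x; rewrite row_mxKl row_mxKr fK gK hsubmxK.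
- by move=> x; rewrite row_mxKl row_mxKr f'K g'K hsubmxK.
- move=> x y; rewrite dsum_mulE -fM -gM; congr row_mx.
    by rewrite /= /dsum_mul row_mxKl.
  by rewrite /= /dsum_mul row_mxKr.
Qed.

End DirectSum.

Section Tensor.
Variable K : fieldType.

(* K^m (x) K^n is K^(m * n), where u (x) v is the flattening of u^T *m v. *)
Definition tens m n (u : 'rV[K]_m) (v : 'rV[K]_n) : 'rV[K]_(m * n) :=
  mxvec (u^T *m v).

(* The linear map on K^m (x) K^n induced by phi; see tlift_tens. *)
Definition tlift m n (V : lmodType K) (phi : 'rV[K]_m -> 'rV[K]_n -> V)
    (x : 'rV[K]_(m * n)) : V :=
  \sum_i \sum_k vec_mx x i k *: phi (delta_mx 0 i) (delta_mx 0 k).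

Lemma tens_bilinear m n : bilinear_for *:%R *:%R (@tens m n).
Proof.
split=> u a x y; rewrite /tens.
  by rewrite linearP /= mulmxDl -scalemxAl linearP.
by rewrite mulmxDr -scalemxAr linearP.
Qed.

Lemma tlift_linear m n (V : lmodType K) (phi : 'rV[K]_m -> 'rV[K]_n -> V) :
  linear (tlift phi).
Proof.
move=> a x y; rewrite /tlift scaler_sumr -big_split; apply: eq_bigr => i _ /=.
rewrite scaler_sumr -big_split; apply: eq_bigr => k _ /=.
by rewrite linearP !mxE scalerDl scalerA.
Qed.

Lemma tlift_tens m n (V : lmodType K) (phi : 'rV[K]_m -> 'rV[K]_n -> V) u v :
  bilinear_for *:%R *:%R phi -> tlift phi (tens u v) = phi u v.
Proof.
move=> phi_bil.
suff tlift_bil (f : {bilinear 'rV[K]_m -> 'rV[K]_n -> V}) :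
  tlift f (tens u v) = f u v by exact: (tlift_bil (bilinear_pack phi_bil)).
rewrite {2}(row_sum_delta u) linear_sumlz; apply: eq_bigr => i _.
rewrite linearZl_LR {2}(row_sum_delta v) linear_sumr scaler_sumr.
apply: eq_bigr => k _; rewrite linearZr_LR scalerA; congr (_ *: _).
by rewrite /tens mxvecK !mxE big_ord_recl big_ord0 addr0 !mxE.
Qed.

Lemma tens_sum m n (x : 'rV[K]_(m * n)) :
  x = \sum_i \sum_k vec_mx x i k *: tens (delta_mx 0 i) (delta_mx 0 k).
Proof.
rewrite -[LHS]vec_mxK {1}(matrix_sum_delta (vec_mx x)) linear_sum.
apply: eq_bigr => i _; rewrite linear_sum; apply: eq_bigr => k _.
rewrite linearZ /=; congr (_ *: _); rewrite /tens trmx_delta.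
by rewrite mul_delta_mx.
Qed.

Lemma tens_ext m n (V : lmodType K) (f g : 'rV[K]_(m * n) -> V) :
  linear f -> linear g -> (forall u v, f (tens u v) = g (tens u v)) -> f =1 g.
Proof.
move=> f_lin g_lin fg x; rewrite -[f]/(linear_pack f_lin : _ -> _).
rewrite -[g]/(linear_pack g_lin : _ -> _) (tens_sum x) !linear_sum.
apply: eq_bigr => i _; rewrite !linear_sum; apply: eq_bigr => k _.
by rewrite !linearZ /= fg.
Qed.

Lemma tlift_linear_param m n (U V : lmodType K)
    (phi : U -> 'rV[K]_m -> 'rV[K]_n -> V) z :
  (forall u v, linear (fun x => phi x u v)) -> linear (fun x => tlift (phi x) z).
Proof.
move=> phi_lin a x y; rewrite /tlift scaler_sumr -big_split.
apply: eq_bigr => i _; rewrite /= scaler_sumr -big_split.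
by apply: eq_bigr => k _; rewrite /= phi_lin scalerDr !scalerA mulrC.
Qed.

Lemma tensPl m n (v : 'rV[K]_n) : linear (fun u : 'rV[K]_m => tens u v).
Proof. exact: (tens_bilinear m n).1. Qed.

Lemma tensPr m n (u : 'rV[K]_m) : linear (fun v : 'rV[K]_n => tens u v).
Proof. exact: (tens_bilinear m n).2. Qed.

Lemma tlift_bil m n m' n' p q (mA : {bilinear 'rV[K]_m -> 'rV[K]_m' -> 'rV[K]_p})
    (mB : {bilinear 'rV[K]_n -> 'rV[K]_n' -> 'rV[K]_q}) y :
  bilinear_for *:%R *:%R
    (fun u v => tlift (fun u' v' => tens (mA u u') (mB v v')) y).
Proof.
by split=> z; apply: tlift_linear_param => u v a x x';
  rewrite linearPl ?tensPl ?tensPr.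
Qed.

Implicit Types A B C D : alg K.

(* The product with (a (x) b) (a' (x) b') = (a a') (x) (b b'), see tensor_mulE. *)
Definition tensor_mul A B (x y : 'rV[K]_(adim A * adim B)) :
    'rV[K]_(adim A * adim B) :=
  tlift (fun u v => tlift (fun u' v' => tens (amul A u u') (amul B v v')) y) x.

Lemma tensor_mul_bilinear A B : bilinear_for *:%R *:%R (@tensor_mul A B).
Proof.
split=> z; first exact: tlift_linear.
by apply: (tlift_linear_param _ _) => u v; apply: tlift_linear.
Qed.

Definition tensor A B : alg K := Alg (bilinear_pack (tensor_mul_bilinear A B)).

Lemma tensor_mulE A B a a' b b' :
  amul (tensor A B) (tens a b) (tens a' b') = tens (amul A a a') (amul B b b').
Proof.
rewrite /= /tensor_mul tlift_tens; last exact: tlift_bil.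
rewrite tlift_tens //; split=> z c u v;
  by rewrite linearPr ?tensPl ?tensPr.
Qed.

(* The base field K as an algebra over itself. *)
Definition base_mul (x y : 'rV[K]_1) : 'rV[K]_1 := x 0 0 *: y.

Lemma base_mul_bilinear : bilinear_for *:%R *:%R base_mul.
Proof.
split=> z a x y; rewrite /base_mul.
  by rewrite !mxE scalerDl -scalerA.
by rewrite scalerDr scalerA mulrC -scalerA.
Qed.

Definition base_alg : alg K := Alg (bilinear_pack base_mul_bilinear).

Lemma tensor_morph A B C (f : 'rV[K]_(adim A * adim B) -> 'rV[K]_(adim C)) :
  linear f ->
  (forall u v u' v', f (tens (amul A u u') (amul B v v')) =
     amul C (f (tens u v)) (f (tens u' v'))) ->
  {morph f : x y / amul (tensor A B) x y >-> amul C x y}.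
Proof.
move=> f_lin fM x y; move: x.
apply: tens_ext => [a u v|a u v|u v].
- by rewrite linearPl f_lin.
- by rewrite f_lin linearPl.
move: y; apply: tens_ext => [a u' v'|a u' v'|u' v'].
- by rewrite linearPr f_lin.
- by rewrite f_lin linearPr.
by rewrite tensor_mulE fM.
Qed.

Lemma swap_bil m n : bilinear_for *:%R *:%R (fun u v => @tens m n v u).
Proof. by split=> z a u v; rewrite ?tensPl ?tensPr. Qed.

Lemma tensor_isoC A B : alg_iso (tensor A B) (tensor B A).
Proof.
have swK m n : cancel (tlift (fun u v => @tens m n v u))
                      (tlift (fun u v => @tens n m v u)).
  apply: tens_ext => [a x y|//|u v]; first by rewrite !tlift_linear.
  by rewrite !tlift_tens //; apply: swap_bil.
apply: (@alg_isoI _ (tensor A B) (tensor B A)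
  (tlift (fun u v => tens v u)) (tlift (fun u v => tens v u))).
- exact: tlift_linear.
- exact: swK.
- exact: swK.
apply: (@tensor_morph A B (tensor B A)) => [|u v u' v']; first exact: tlift_linear.
by rewrite !tlift_tens ?tensor_mulE //; apply: swap_bil.
Qed.

Lemma tens_idK m n (x : 'rV[K]_(m * n)) : tlift (fun u v => tens u v) x = x.
Proof.
move: x; apply: tens_ext => [||u v] //; first exact: tlift_linear.
by rewrite tlift_tens //; apply: tens_bilinear.
Qed.

Lemma tensor_isoA A B C :
  alg_iso (tensor A (tensor B C)) (tensor (tensor A B) C).
Proof.
pose f m n p (u : 'rV[K]_m) (z : 'rV[K]_(n * p)) :=
  tlift (fun v w => tens (tens u v) w) z.
pose g m n p (z : 'rV[K]_(m * n)) (w : 'rV[K]_p) :=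
  tlift (fun u v => tens u (tens v w)) z.
have f0_bil m n p (u : 'rV[K]_m) :
    bilinear_for *:%R *:%R (fun (v : 'rV[K]_n) (w : 'rV[K]_p) => tens (tens u v) w).
  by split=> z a x y; rewrite ?tensPr ?tensPl.
have g0_bil m n p (w : 'rV[K]_p) :
    bilinear_for *:%R *:%R (fun (u : 'rV[K]_m) (v : 'rV[K]_n) => tens u (tens v w)).
  by split=> z a x y; rewrite ?tensPl ?tensPr.
have f_bil m n p : bilinear_for *:%R *:%R (@f m n p).
  split=> z; last exact: tlift_linear.
  by apply: tlift_linear_param => v w a x y; rewrite tensPl tensPl.
have g_bil m n p : bilinear_for *:%R *:%R (@g m n p).
  split=> z; first exact: tlift_linear.
  by apply: tlift_linear_param => u v a x y; rewrite tensPr tensPr.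
have fE m n p u v w : tlift (@f m n p) (tens u (tens v w)) = tens (tens u v) w.
  by rewrite tlift_tens ?/f ?tlift_tens.
have gE m n p u v w : tlift (@g m n p) (tens (tens u v) w) = tens u (tens v w).
  by rewrite tlift_tens ?/g ?tlift_tens.
apply: (@alg_isoI _ (tensor A (tensor B C)) (tensor (tensor A B) C)
  (tlift (@f _ _ _)) (tlift (@g _ _ _))).
- exact: tlift_linear.
- apply: tens_ext => [a x y|//|u z]; first by rewrite !tlift_linear.
  move: z; apply: tens_ext => [a x y|a x y|v w].
  + by rewrite tensPr !tlift_linear.
  + by rewrite tensPr.
  + by rewrite fE gE.
- apply: tens_ext => [a x y|//|z w]; first by rewrite !tlift_linear.
  move: z; apply: tens_ext => [a x y|a x y|u v].
  + by rewrite tensPl !tlift_linear.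
  + by rewrite tensPl.
  + by rewrite gE fE.
- apply: (@tensor_morph A (tensor B C) (tensor (tensor A B) C)) => [|u z u' z']; first exact: tlift_linear.
  have fL := @tlift_linear _ _ _ (@f (adim A) (adim B) (adim C)).
  move: z; apply: tens_ext => [a x y|a x y|v w].
  + by rewrite linearPl tensPr fL.
  + by rewrite tensPr fL linearPl.
  move: z'; apply: tens_ext => [a x y|a x y|v' w'].
  + by rewrite linearPr tensPr fL.
  + by rewrite tensPr fL linearPr.
  by rewrite tensor_mulE !fE !tensor_mulE.
Qed.

Lemma tensZl m n c (u : 'rV[K]_m) (v : 'rV[K]_n) :
  tens (c *: u) v = c *: tens u v.
Proof. by rewrite /tens linearZ -scalemxAl linearZ. Qed.

Lemma tensZr m n c (u : 'rV[K]_m) (v : 'rV[K]_n) :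
  tens u (c *: v) = c *: tens u v.
Proof. by rewrite /tens -scalemxAr linearZ. Qed.

Lemma tensor_iso1 A : alg_iso (tensor base_alg A) A.
Proof.
pose f (u : 'rV[K]_1) (v : 'rV[K]_(adim A)) := u 0 0 *: v.
have f_bil : bilinear_for *:%R *:%R f.
  split=> z a x y; rewrite /f; first by rewrite !mxE scalerDl -scalerA.
  by rewrite scalerDr scalerA mulrC -scalerA.
apply: (@alg_isoI _ (tensor base_alg A) A (tlift f) (tens (const_mx 1))).
- exact: tlift_linear.
- apply: tens_ext => [a x y|//|u v]; first by rewrite tlift_linear tensPr.
  rewrite tlift_tens // /f tensZr -tensZl; congr tens.
  by apply/rowP => i; rewrite ord1 !mxE mulr1.
- by move=> v; rewrite tlift_tens // /f mxE scale1r.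
apply: (@tensor_morph base_alg A A) => [|u v u' v']; first exact: tlift_linear.
rewrite !tlift_tens // /f linearZl_LR linearZr_LR scalerA.
by rewrite /= /base_mul mxE.
Qed.

Lemma tensor_iso A B C D :
  alg_iso A C -> alg_iso B D -> alg_iso (tensor A B) (tensor C D).
Proof.
case/alg_iso_inv=> f [f' [fK f'K fM _]] /alg_iso_inv[g [g' [gK g'K gM _]]].
have fg_bil m n m' n' (h : {linear 'rV[K]_m -> 'rV[K]_m'})
    (k : {linear 'rV[K]_n -> 'rV[K]_n'}) :
    bilinear_for *:%R *:%R (fun u v => tens (h u) (k v)).
  by split=> z a u v; rewrite linearP ?tensPl ?tensPr.
apply: (@alg_isoI _ (tensor A B) (tensor C D)
  (tlift (fun u v => tens (f u) (g v))) (tlift (fun u v => tens (f' u) (g' v)))).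
- exact: tlift_linear.
- apply: tens_ext => [a x y|//|u v]; first by rewrite !tlift_linear.
  by rewrite !tlift_tens ?fK ?gK.
- apply: tens_ext => [a x y|//|u v]; first by rewrite !tlift_linear.
  by rewrite !tlift_tens ?f'K ?g'K.
- apply: (@tensor_morph A B (tensor C D)) => [|u v u' v'].
    exact: tlift_linear.
  by rewrite !tlift_tens // tensor_mulE fM gM.
Qed.

Lemma tensor_isoDl A B C :
  alg_iso (tensor (dsum A B) C) (dsum (tensor A C) (tensor B C)).
Proof.
pose f (u : 'rV[K]_(adim A + adim B)) (v : 'rV[K]_(adim C)) :=
  row_mx (tens (lsubmx u) v) (tens (rsubmx u) v).
pose gl (u : 'rV[K]_(adim A)) (v : 'rV[K]_(adim C)) :=
  tens (row_mx u (0 : 'rV[K]_(adim B))) v.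
pose gr (u : 'rV[K]_(adim B)) (v : 'rV[K]_(adim C)) :=
  tens (row_mx (0 : 'rV[K]_(adim A)) u) v.
have f_bil : bilinear_for *:%R *:%R f.
  by split=> z a u v; rewrite /f ?linearP /= ?tensPl ?tensPr scale_row_mx add_row_mx.
have gl_bil : bilinear_for *:%R *:%R gl.
  split=> z a u v; rewrite /gl ?tensPr // -tensPl scale_row_mx add_row_mx.
  by rewrite scaler0 addr0.
have gr_bil : bilinear_for *:%R *:%R gr.
  split=> z a u v; rewrite /gr ?tensPr // -tensPl scale_row_mx add_row_mx.
  by rewrite scaler0 addr0.
have fE u u' v : tlift f (tens (row_mx u u') v) = row_mx (tens u v) (tens u' v).
  by rewrite tlift_tens // /f row_mxKl row_mxKr.
have fL : linear (tlift f) by exact: tlift_linear.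
pose g (x : 'rV[K]_(adim A * adim C + adim B * adim C)) :=
  tlift gl (lsubmx x) + tlift gr (rsubmx x).
have gL : linear g.
  move=> a x y; rewrite /g !linearP /= !tlift_linear scalerDr -!addrA.
  by congr (_ + _); rewrite addrCA.
have row0 m n p (u : 'rV[K]_m) (u' : 'rV[K]_n) (v : 'rV[K]_p) :
    tens (row_mx u 0) v + tens (row_mx 0 u') v = tens (row_mx u u') v.
  rewrite -[X in X + _ = _]scale1r -tensPl scale1r add_row_mx.
  by rewrite addr0 add0r.
have tens0 m n (v : 'rV[K]_n) : tens (0 : 'rV[K]_m) v = 0.
  by rewrite -(scale0r (0 : 'rV[K]_m)) tensZl scale0r.
have fgl x : tlift f (tlift gl x) = row_mx x 0.
  move: x; apply: tens_ext => [a x y|a x y|u v].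
  - by rewrite !tlift_linear.
  - by rewrite scale_row_mx add_row_mx scaler0 addr0.
  - by rewrite tlift_tens // fE tens0.
have fgr x : tlift f (tlift gr x) = row_mx 0 x.
  move: x; apply: tens_ext => [a x y|a x y|u v].
  - by rewrite !tlift_linear.
  - by rewrite scale_row_mx add_row_mx scaler0 addr0.
  - by rewrite tlift_tens // fE tens0.
apply: (@alg_isoI _ (tensor (dsum A B) C) (dsum (tensor A C) (tensor B C))
  (tlift f) g) => //.
- apply: tens_ext => [a x y|//|u v]; first by rewrite fL gL.
  rewrite tlift_tens // /g /f row_mxKl row_mxKr !tlift_tens // /gl /gr row0.
  by rewrite hsubmxK.
- move=> x; rewrite /g -[X in X + _]scale1r fL scale1r fgl fgr add_row_mx.
  by rewrite addr0 add0r hsubmxK.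
apply: (@tensor_morph (dsum A B) C (dsum (tensor A C) (tensor B C)))
  => // u v u' v'.
rewrite -[u]hsubmxK -[u']hsubmxK dsum_mulE !fE.
by rewrite dsum_mulE !tensor_mulE.
Qed.

Lemma tensor_iso0 A : alg_iso (tensor (zero_alg K) A) (zero_alg K).
Proof.
by apply: (@alg_isoI _ (tensor (zero_alg K) A) (zero_alg K) (fun=> 0) (fun=> 0))
  => [a x y|x|x|x y]; rewrite [RHS]thinmx0 [LHS]thinmx0.
Qed.

End Tensor.

Section NonDegenerate.
Variable K : fieldType.
Implicit Types A B : alg K.

(* A spanning family with as many members as the dimension is a basis. *)
Lemma nondegenerateI A (b : seq 'rV[K]_(adim A)) :
  size b = adim A -> (forall x, x \in <<b>>%VS) ->
  {in b &, forall x y, x != y -> amul A x y = 0} ->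
  {in b, forall x, amul A x x != 0} -> nondegenerate (A := A) fullv.
Proof.
move=> size_b span_b b_nat b_nd; exists b => //; split=> //.
rewrite basisEdim dimvf /dim /= mul1n size_b leqnn andbT.
by apply/subvP => x _.
Qed.

Lemma nondegenerateE A : nondegenerate (A := A) fullv ->
  exists b : seq 'rV[K]_(adim A), [/\ size b = adim A, (forall x, x \in <<b>>%VS),
    {in b &, forall x y, x != y -> amul A x y = 0}
  & {in b, forall x, amul A x x != 0}].
Proof.
case=> b [b_basis b_nat] b_nd; exists b; split=> //.
  have := size_basis (X := in_tuple b) b_basis.
  by rewrite dimvf /dim /= mul1n.
by move=> x; rewrite (span_basis b_basis) memvf.
Qed.

Lemma zero_nondegenerate : nondegenerate (A := zero_alg K) fullv.
Proof.
apply: (@nondegenerateI (zero_alg K) [::]) => // x.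
by rewrite [x](thinmx0 x) mem0v.
Qed.

Lemma base_nondegenerate : nondegenerate (A := base_alg K) fullv.
Proof.
apply: (@nondegenerateI (base_alg K) [:: const_mx 1]) => //.
- move=> x; rewrite span_seq1; apply/vlineP; exists (x 0 0).
  by apply/rowP => i; rewrite ord1 !mxE mulr1.
- by move=> x y /[!inE] /eqP -> /eqP -> /eqP.
- move=> x /[!inE] /eqP ->; apply/eqP => /rowP/(_ 0).
  by rewrite !mxE mulr1 => /eqP; rewrite oner_eq0.
Qed.

Lemma dsum_nondegenerate A B : nondegenerate (A := A) fullv ->
  nondegenerate (A := B) fullv -> nondegenerate (A := dsum A B) fullv.
Proof.
case/nondegenerateE=> b [size_b span_b b_nat b_nd].
case/nondegenerateE=> c [size_c span_c c_nat c_nd].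
pose f (x : 'rV[K]_(adim A)) : 'rV[K]_(adim A + adim B) := row_mx x 0.
pose g (x : 'rV[K]_(adim B)) : 'rV[K]_(adim A + adim B) := row_mx 0 x.
have mulfg x y : amul (dsum A B) (f x) (g y) = 0.
  by rewrite dsum_mulE linear0r linear0l row_mx0.
have mulgf x y : amul (dsum A B) (g x) (f y) = 0.
  by rewrite dsum_mulE linear0r linear0l row_mx0.
have mulff x y : amul (dsum A B) (f x) (f y) = f (amul A x y).
  by rewrite dsum_mulE linear0r.
have mulgg x y : amul (dsum A B) (g x) (g y) = g (amul B x y).
  by rewrite dsum_mulE linear0r.
have f0 x : (f x == 0) = (x == 0).
  apply/eqP/eqP => [/(congr1 lsubmx)|->]; last exact: row_mx0.
  by rewrite row_mxKl linear0.
have g0 x : (g x == 0) = (x == 0).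
  apply/eqP/eqP => [/(congr1 rsubmx)|->]; last exact: row_mx0.
  by rewrite row_mxKr linear0.
have f_lin : linear f.
  by move=> a x y; rewrite /f scale_row_mx add_row_mx scaler0 addr0.
have g_lin : linear g.
  by move=> a x y; rewrite /g scale_row_mx add_row_mx scaler0 addr0.
have fS x : f x \in <<map f b>>%VS.
  rewrite (coord_span (X := in_tuple b) (span_b x)).
  rewrite -[f _]/(linear_pack f_lin _) linear_sum memv_suml // => i _.
  by rewrite linearZ memvZ ?memv_span ?map_f ?mem_nth.
have gS x : g x \in <<map g c>>%VS.
  rewrite (coord_span (X := in_tuple c) (span_c x)).
  rewrite -[g _]/(linear_pack g_lin _) linear_sum memv_suml // => i _.
  by rewrite linearZ memvZ ?memv_span ?map_f ?mem_nth.
apply: (@nondegenerateI (dsum A B) (map f b ++ map g c)).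
- by rewrite size_cat !size_map size_b size_c.
- move=> x; have -> : x = f (lsubmx (x : 'rV_(_ + _))) + g (rsubmx (x : 'rV_(_ + _))).
    by rewrite add_row_mx addr0 add0r hsubmxK.
  by rewrite span_cat memv_add.
- move=> x y; rewrite !mem_cat.
  case/orP=> /mapP[x' x'b ->] /orP[] /mapP[y' y'b ->] xy //.
    rewrite mulff b_nat //; first by apply/eqP; rewrite f0.
    by apply: contraNneq xy => ->.
  rewrite mulgg c_nat //; first by apply/eqP; rewrite g0.
  by apply: contraNneq xy => ->.
- move=> x; rewrite mem_cat => /orP[] /mapP[y yb ->].
    by rewrite mulff f0 b_nd.
  by rewrite mulgg g0 c_nd.
Qed.

Lemma tensor_nondegenerate A B : nondegenerate (A := A) fullv ->
  nondegenerate (A := B) fullv -> nondegenerate (A := tensor A B) fullv.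
Proof.
case/nondegenerateE=> b [size_b span_b b_nat b_nd].
case/nondegenerateE=> c [size_c span_c c_nat c_nd].
have t0l m n (v : 'rV[K]_n) : tens (0 : 'rV[K]_m) v = 0.
  by rewrite -(scale0r (0 : 'rV[K]_m)) tensZl scale0r.
have t0r m n (u : 'rV[K]_m) : tens u (0 : 'rV[K]_n) = 0.
  by rewrite -(scale0r (0 : 'rV[K]_n)) tensZr scale0r.
have t0 m n (u : 'rV[K]_m) (v : 'rV[K]_n) : u != 0 -> v != 0 -> tens u v != 0.
  case/rV0Pn=> i ui0 /rV0Pn[k vk0]; apply/eqP => /(congr1 vec_mx).
  rewrite /tens mxvecK linear0 => /matrixP/(_ i k)/eqP.
  by rewrite !mxE big_ord_recl big_ord0 addr0 !mxE mulf_eq0 (negPf ui0) (negPf vk0).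
pose bc := [seq tens x y | x <- b, y <- c].
have tS u v : tens u v \in <<bc>>%VS.
  rewrite (coord_span (X := in_tuple b) (span_b u)).
  rewrite -[tens _ v]/(linear_pack (@tensPl _ _ _ v) _).
  rewrite linear_sum memv_suml // => i _; rewrite linearZ memvZ //=.
  rewrite (coord_span (X := in_tuple c) (span_c v)).
  rewrite -[tens _ _]/(linear_pack (@tensPr _ _ _ _) _).
  rewrite linear_sum memv_suml // => k _; rewrite linearZ memvZ //=.
  by rewrite memv_span // allpairs_f ?mem_nth.
apply: (@nondegenerateI (tensor A B) bc).
- by rewrite size_allpairs size_b size_c.
- move=> x; rewrite (tens_sum x).
  by do 2![apply: memv_suml => ? _]; rewrite memvZ.
- move=> _ _ /allpairsP[[u v] /= [ub vc ->]] /allpairsP[[u' v'] /= [ub' vc' ->]] ne.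
  rewrite [LHS]tensor_mulE; have [uu'|?] := eqVneq u u'; last by rewrite b_nat // t0l.
  have [vv'|?] := eqVneq v v'; last by rewrite c_nat // t0r.
  by rewrite uu' vv' eqxx in ne.
- move=> _ /allpairsP[[u v] /= [ub vc ->]].
  by rewrite [X in X != 0]tensor_mulE t0 ?b_nd ?c_nd.
Qed.

(* The cyclic algebra; ordS is the successor modulo n on 'I_n. *)
Definition cyclic_mul n (x y : 'rV[K]_n) : 'rV[K]_n :=
  \sum_(i < n) (x 0 i * y 0 i) *: delta_mx 0 (ordS i).

Lemma cyclic_mul_bilinear n : bilinear_for *:%R *:%R (@cyclic_mul n).
Proof.
split=> z a x y; rewrite /cyclic_mul /= scaler_sumr -big_split;
  apply: eq_bigr => i _ /=; rewrite !mxE scalerA -scalerDl; congr (_ *: _).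
  by rewrite mulrDl mulrA.
by rewrite mulrDr mulrCA.
Qed.

Definition cyclic_alg n : alg K := Alg (bilinear_pack (@cyclic_mul_bilinear n)).

Lemma cyclic_mulE n i j : amul (cyclic_alg n) (delta_mx 0 i) (delta_mx 0 j) =
  if i == j then delta_mx 0 (ordS i) else 0.
Proof.
rewrite /= /cyclic_mul (bigD1 i) //= big1 => [|k k_neq_i].
  rewrite !mxE !eqxx mul1r addr0 /= eq_sym.
  by case: eqP => _; rewrite ?scale1r ?scale0r.
by rewrite !mxE (negPf k_neq_i) mul0r scale0r.
Qed.

Lemma cyclic_nondegenerate n : nondegenerate (A := cyclic_alg n) fullv.
Proof.
apply: (@nondegenerateI (cyclic_alg n) [seq delta_mx 0 i | i <- enum 'I_n]).
- by rewrite size_map size_enum_ord.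
- move=> x; rewrite (row_sum_delta x) memv_suml // => i _.
  by rewrite memvZ // memv_span // map_f // mem_enum.
- move=> _ _ /mapP[i _ ->] /mapP[j _ ->] ne; rewrite cyclic_mulE ifN //.
  by apply: contraNneq ne => ->.
- move=> _ /mapP[i _ ->]; rewrite cyclic_mulE eqxx.
  apply/eqP => /rowP/(_ (ordS i))/eqP.
  by rewrite !mxE !eqxx oner_eq0.
Qed.

End NonDegenerate.

Section IsoClasses.
Variable K : fieldType.

Record ndalg := NdAlg {
  ndalg_alg :> alg K;
  ndalg_nondegenerate : nondegenerate (A := ndalg_alg) fullv }.

HB.instance Definition _ := gen_eqMixin ndalg.
HB.instance Definition _ := gen_choiceMixin ndalg.

Definition nd_dsum (X Y : ndalg) : ndalg :=
  NdAlg (dsum_nondegenerate (ndalg_nondegenerate X) (ndalg_nondegenerate Y)).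
Definition nd_tensor (X Y : ndalg) : ndalg :=
  NdAlg (tensor_nondegenerate (ndalg_nondegenerate X) (ndalg_nondegenerate Y)).
Definition nd_zero : ndalg := NdAlg (zero_nondegenerate K).
Definition nd_base : ndalg := NdAlg (base_nondegenerate K).
Definition nd_cyclic n : ndalg := NdAlg (cyclic_nondegenerate K n).

Definition nd_iso (X Y : ndalg) : bool := `[< alg_iso X Y >].

Lemma nd_iso_equiv : equiv_class_of nd_iso.
Proof.
split=> [X|X Y|Y X Z].
- exact/asboolP/alg_iso_refl.
- by apply/asboolP/asboolP => /alg_iso_sym.
- by move=> /asboolP XY /asboolP YZ; apply/asboolP/(alg_iso_trans XY YZ).
Qed.

Canonical nd_iso_rel := EquivRelPack nd_iso_equiv.

Definition isoclass := {eq_quot nd_iso}.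
HB.instance Definition _ := Choice.on isoclass.
HB.instance Definition _ := EqQuotient.on isoclass.

Implicit Types X Y Z : ndalg.

Lemma isoclassP X Y : \pi_isoclass X = \pi_isoclass Y <-> alg_iso X Y.
Proof. by split=> [/eqmodP/asboolP|?]; last exact/eqmodP/asboolP. Qed.

Definition ic_add (x y : isoclass) : isoclass := \pi_isoclass (nd_dsum (repr x) (repr y)).
Definition ic_mul (x y : isoclass) : isoclass := \pi_isoclass (nd_tensor (repr x) (repr y)).
Definition ic_zero : isoclass := \pi_isoclass nd_zero.
Definition ic_one : isoclass := \pi_isoclass nd_base.

Lemma alg_iso_repr X : alg_iso (repr (\pi_isoclass X)) X.
Proof. by apply/isoclassP; rewrite reprK. Qed.

Lemma ic_addE X Y : ic_add (\pi_isoclass X) (\pi_isoclass Y) = \pi_isoclass (nd_dsum X Y).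
Proof. by apply/isoclassP/dsum_iso; apply: alg_iso_repr. Qed.

Lemma ic_mulE X Y : ic_mul (\pi_isoclass X) (\pi_isoclass Y) = \pi_isoclass (nd_tensor X Y).
Proof. by apply/isoclassP/tensor_iso; apply: alg_iso_repr. Qed.

Lemma ic_addA : associative ic_add.
Proof.
elim/quotW=> X; elim/quotW=> Y; elim/quotW=> Z.
rewrite (ic_addE Y Z) (ic_addE X Y) !ic_addE.
apply/isoclassP; exact: (dsum_isoA X Y Z).
Qed.

Lemma ic_addC : commutative ic_add.
Proof.
elim/quotW=> X; elim/quotW=> Y; rewrite !ic_addE.
apply/isoclassP; exact: (dsum_isoC X Y).
Qed.

Lemma ic_add0 : left_id ic_zero ic_add.
Proof. by elim/quotW=> X; rewrite ic_addE; apply/isoclassP; exact: (dsum_iso0 X). Qed.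

HB.instance Definition _ := GRing.isNmodule.Build isoclass ic_addA ic_addC ic_add0.

Lemma ic_mulA : associative ic_mul.
Proof.
elim/quotW=> X; elim/quotW=> Y; elim/quotW=> Z.
rewrite (ic_mulE Y Z) (ic_mulE X Y) !ic_mulE.
apply/isoclassP; exact: (tensor_isoA X Y Z).
Qed.

Lemma ic_mulC : commutative ic_mul.
Proof.
elim/quotW=> X; elim/quotW=> Y; rewrite !ic_mulE.
apply/isoclassP; exact: (tensor_isoC X Y).
Qed.

Lemma ic_mul1 : left_id ic_one ic_mul.
Proof. by elim/quotW=> X; rewrite ic_mulE; apply/isoclassP; exact: (tensor_iso1 X). Qed.

Lemma ic_mulDl : left_distributive ic_mul ic_add.
Proof.
elim/quotW=> X; elim/quotW=> Y; elim/quotW=> Z.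
rewrite (ic_addE X Y) (ic_mulE X Z) (ic_mulE Y Z) ic_addE ic_mulE.
apply/isoclassP; exact: (tensor_isoDl X Y Z).
Qed.

Lemma ic_mul0 : left_zero ic_zero ic_mul.
Proof. by elim/quotW=> X; rewrite ic_mulE; apply/isoclassP; exact: (tensor_iso0 X). Qed.

HB.instance Definition _ := GRing.Nmodule_isComPzSemiRing.Build isoclass
  ic_mulA ic_mulC ic_mul1 ic_mulDl ic_mul0.

End IsoClasses.

(* The group completion of the additive monoid of a commutative semiring, with
   the induced product: (a, b) stands for the formal difference a - b. *)
Section Completion.
Variable S : comPzSemiRingType.
Implicit Types p q r : S * S.

Definition diff_eq p q : bool := `[< exists k, p.1 + q.2 + k = q.1 + p.2 + k >].

Lemma diff_eq_equiv : equiv_class_of diff_eq.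
Proof.
split=> [p|p q|q p r].
- by apply/asboolP; exists 0.
- by apply/asboolP/asboolP => -[k e]; exists k.
- move=> /asboolP[k e] /asboolP[l e']; apply/asboolP.
  exists (q.1 + q.2 + k + l).
  transitivity ((p.1 + q.2 + k) + (q.1 + r.2 + l)); first by ring.
  by rewrite e e'; ring.
Qed.

Canonical diff_eq_rel := EquivRelPack diff_eq_equiv.

Definition completion := {eq_quot diff_eq}.
HB.instance Definition _ := Choice.on completion.
HB.instance Definition _ := EqQuotient.on completion.

Lemma completionP p q : \pi_completion p = \pi_completion q <->
  exists k, p.1 + q.2 + k = q.1 + p.2 + k.
Proof. by split=> [/eqmodP/asboolP|?]; last exact/eqmodP/asboolP. Qed.

Definition diff_add p q := (p.1 + q.1, p.2 + q.2).
Definition diff_opp p := (p.2, p.1).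
Definition diff_mul p q :=
  (p.1 * q.1 + p.2 * q.2, p.1 * q.2 + p.2 * q.1).

Definition cp_zero : completion := \pi_completion (0, 0).
Definition cp_one : completion := \pi_completion (1, 0).
Definition cp_add (x y : completion) : completion :=
  \pi_completion (diff_add (repr x) (repr y)).
Definition cp_opp (x : completion) : completion := \pi_completion (diff_opp (repr x)).
Definition cp_mul (x y : completion) : completion :=
  \pi_completion (diff_mul (repr x) (repr y)).

Lemma cp_addE p q : cp_add (\pi_completion p) (\pi_completion q) = \pi_completion (diff_add p q).
Proof.
have /completionP[k e] := reprK (\pi_completion p).
have /completionP[l e'] := reprK (\pi_completion q).
apply/completionP; exists (k + l).
move: (repr _) (repr _) e e' => q' p' e e' /=.
transitivity ((p'.1 + p.2 + k) + (q'.1 + q.2 + l)); first by ring.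
by rewrite e e'; ring.
Qed.

Lemma cp_oppE p : cp_opp (\pi_completion p) = \pi_completion (diff_opp p).
Proof.
have /completionP[k e] := reprK (\pi_completion p).
apply/completionP; exists k; move: (repr _) e => p' e /=.
transitivity (p.1 + p'.2 + k); first by ring.
by rewrite -e; ring.
Qed.

Lemma cp_mulE p q : cp_mul (\pi_completion p) (\pi_completion q) = \pi_completion (diff_mul p q).
Proof.
have mulC x y : cp_mul x y = cp_mul y x.
  by apply/completionP; exists 0; rewrite /=; ring.
have mulEl x y : \pi_completion (diff_mul (repr (\pi_completion x)) y) = \pi_completion (diff_mul x y).
  have /completionP[k e] := reprK (\pi_completion x).
  apply/completionP; exists (k * (y.1 + y.2)).
  move: (repr _) e => x' e /=.
  transitivity ((x'.1 + x.2 + k) * y.1 + (x.1 + x'.2 + k) * y.2); first by ring.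
  by rewrite e -{2}e; ring.
rewrite /cp_mul mulEl.
transitivity (\pi_completion (diff_mul (repr (\pi_completion q)) p)).
  by apply/completionP; exists 0; rewrite /=; ring.
by rewrite mulEl; apply/completionP; exists 0; rewrite /=; ring.
Qed.

Lemma cp_addA : associative cp_add.
Proof.
elim/quotW=> x; elim/quotW=> y; elim/quotW=> z.
rewrite (cp_addE y z) (cp_addE x y) !cp_addE.
by apply/completionP; exists 0; rewrite /=; ring.
Qed.

Lemma cp_addC : commutative cp_add.
Proof.
elim/quotW=> x; elim/quotW=> y; rewrite !cp_addE.
by apply/completionP; exists 0; rewrite /=; ring.
Qed.

Lemma cp_add0 : left_id cp_zero cp_add.
Proof.
elim/quotW=> x; rewrite cp_addE.
by apply/completionP; exists 0; rewrite /=; ring.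
Qed.

Lemma cp_addN : left_inverse cp_zero cp_opp cp_add.
Proof.
elim/quotW=> x; rewrite cp_oppE cp_addE.
by apply/completionP; exists 0; rewrite /=; ring.
Qed.

HB.instance Definition _ :=
  GRing.isZmodule.Build completion cp_addA cp_addC cp_add0 cp_addN.

Lemma cp_mulA : associative cp_mul.
Proof.
elim/quotW=> x; elim/quotW=> y; elim/quotW=> z.
rewrite (cp_mulE y z) (cp_mulE x y) !cp_mulE.
by apply/completionP; exists 0; rewrite /=; ring.
Qed.

Lemma cp_mulC : commutative cp_mul.
Proof.
elim/quotW=> x; elim/quotW=> y; rewrite !cp_mulE.
by apply/completionP; exists 0; rewrite /=; ring.
Qed.

Lemma cp_mul1 : left_id cp_one cp_mul.
Proof.
elim/quotW=> x; rewrite cp_mulE.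
by apply/completionP; exists 0; rewrite /=; ring.
Qed.

Lemma cp_mulDl : left_distributive cp_mul cp_add.
Proof.
elim/quotW=> x; elim/quotW=> y; elim/quotW=> z.
rewrite (cp_addE x y) (cp_mulE x z) (cp_mulE y z) cp_addE cp_mulE.
by apply/completionP; exists 0; rewrite /=; ring.
Qed.

HB.instance Definition _ := GRing.Zmodule_isComPzRing.Build completion
  cp_mulA cp_mulC cp_mul1 cp_mulDl.

Definition completion_in (a : S) : completion := \pi_completion (a, 0).

End Completion.

Definition grothendieck (K : fieldType) : comPzRingType :=
  completion (isoclass K).

Definition gclass (K : fieldType) (X : ndalg K) : grothendieck K :=
  completion_in (\pi_(isoclass K) X).

Lemma gclassD (K : fieldType) (X Y : ndalg K) :
  gclass (nd_dsum X Y) = gclass X + gclass Y.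
Proof.
by rewrite [RHS]cp_addE /gclass /completion_in -ic_addE; apply/completionP;
  exists 0 => /=; rewrite !addr0.
Qed.

Lemma gclassM (K : fieldType) (X Y : ndalg K) :
  gclass (nd_tensor X Y) = gclass X * gclass Y.
Proof.
rewrite [RHS]cp_mulE /gclass /completion_in -ic_mulE; apply/completionP.
by exists 0 => /=; rewrite !mulr0 mul0r !addr0.
Qed.

Lemma gclass1 (K : fieldType) : gclass (nd_base K) = 1.
Proof. by []. Qed.

Definition zero_divisor (R : comPzRingType) (a : R) : Prop :=
  exists2 b : R, b != 0 & a * b = 0.

Definition cyclic_sum (K : fieldType) r (n : 'I_r -> nat) : ndalg K :=
  \big[@nd_dsum K/nd_zero K]_(i < r) nd_cyclic K (n i).

(* Main.v *)
(* Write c_n for the class of C_n, so that c_n c_n = n c_n. If every n_i > 1,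
   then the product of the n_i - c_(n_i) is annihilated by [X]; it is nonzero
   because C_n (x) B has no nonzero homomorphism to K when n > 1,
   whereas the constant term contributes copies of K. If some n_i = 1, then [X]
   is 1 plus a sum of c_n, and the quadratic relations show that [X] b = 0
   implies N b = 0 for some N > 0; so everything reduces to cancellation and
   torsion-freeness of the monoid of isomorphism classes. These hold because the
   monoid has the refinement property: since the annihilator is zero, the
   projections attached to two direct sum decompositions commute.
   For the balance, X has a natural basis permuted by squaring, every natural
   basis of a summand is a rescaling of part of it, and an indecomposable
   summand of balance 1 is a fixed point of the permutation. *)
Require Import Defs.
From mathcomp Require Import all_boot all_order all_algebra.
From mathcomp Require Import ring zify boolp.
(* Restores [nondegenerate], shadowed by the sesquilinear forms of all_algebra. *)
Import Defs.

Set Implicit Arguments.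
Unset Strict Implicit.
Unset Printing Implicit Defensive.

Import GRing.Theory.
Local Open Scope ring_scope.
Local Open Scope quotient_scope.

(** * Cancellation and torsion-freeness of a refinement monoid with a dimension *)

Section RefinementMonoid.
Variables (M : nmodType) (dim : M -> nat).
Hypothesis dimD : forall x y, dim (x + y) = (dim x + dim y)%N.
Hypothesis dim_eq0 : forall x, dim x = 0%N -> x = 0.
Hypothesis refine : forall a b c d : M, a + b = c + d ->
  exists p q r s, [/\ a = p + q, b = r + s, c = p + r & d = q + s].

Definition atom (p : M) := p <> 0 /\ forall a b, p = a + b -> a = 0 \/ b = 0.

Lemma atom_summand x : x <> 0 -> exists p y, atom p /\ x = p + y.
Proof.
have [n] := ubnP (dim x); elim: n x => // n IHn x; rewrite ltnS => x_n x0.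
have [xa|] := pselect (atom x); first by exists x, 0; rewrite addr0.
move=> /not_andP[//|] /existsNP[a] /existsNP[b] /not_implyP[xab] /not_orP[a0 b0].
have b_gt0 : (0 < dim b)%N by rewrite lt0n; apply/eqP => /dim_eq0.
have [||p [y [pa ay]]] := IHn a => //.
  by rewrite (leq_trans _ x_n) // xab dimD -[ltnLHS]addn0 ltn_add2l.
by exists p, (y + b); rewrite addrA -ay.
Qed.

Lemma refinement_addr_eq0 (a b : M) : a + b = 0 -> a = 0.
Proof.
have d0 : dim 0 = 0%N.
  by apply/eqP; rewrite -(eqn_add2l (dim 0)) -dimD addr0 addn0.
by move=> /(congr1 dim)/eqP; rewrite dimD d0 addn_eq0 => /andP[/eqP/dim_eq0].
Qed.

Lemma summand_eq0 (a b : M) : a + b = b -> a = 0.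
Proof.
by move=> /(congr1 dim)/eqP; rewrite dimD -[eqbRHS]add0n eqn_add2r => /eqP/dim_eq0.
Qed.

(** Atoms of [y] are split off one at a time, which reduces the claim to cancelling a single atom
    [p]; a refinement of [a + p = b + p] then settles that case. *)
Lemma refinement_addIr (a b y : M) : a + y = b + y -> a = b.
Proof.
have [n] := ubnP (dim y); elim: n a b y => // n IHn a b y; rewrite ltnS => y_n.
have [->|/atom_summand[p [z [p_atom yE]]]] := pselect (y = 0).
  by rewrite !addr0.
rewrite yE !addrA => e.
have {}e : a + p = b + p.
  apply: IHn e; apply: leq_trans y_n; rewrite yE dimD -[ltnLHS]add0n ltn_add2r lt0n.
  by apply/eqP => /dim_eq0; apply: p_atom.1.
(* Here [a = u + v], [b = u + w] and [p = w + t = v + t]. If [w = 0], then [t = p] forces [v = 0];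
   if [t = 0], then [v = p = w]. *)
have [u [v [w [t [-> pw -> pv]]]]] := refine e.
have [w0|t0] := p_atom.2 _ _ pw.
- move: pw; rewrite w0 add0r => pt; rewrite -pt in pv.
  by rewrite (summand_eq0 (esym pv)).
- by congr (_ + _); rewrite -[v]addr0 -[w]addr0 -t0 -pv -pw.
Qed.

(** Atoms are prime: a refinement of [p + c = b + b *+ n] puts the indecomposable [p] wholly inside
    [b] or wholly inside [b *+ n], where induction applies. *)
Lemma atom_summand_mulrn (p b c : M) n :
  atom p -> p + c = b *+ n -> exists d, b = p + d.
Proof.
move=> p_atom; elim: n c => [|n IHn] c.
  by rewrite mulr0n => /refinement_addr_eq0/p_atom.1.
rewrite mulrS => /refine[u [v [w [t [pE cE bE nE]]]]].
have [u0|v0] := p_atom.2 _ _ pE.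
  by apply: (IHn t); rewrite nE pE u0 add0r.
by exists w; rewrite bE pE v0 addr0.
Qed.

(** By primality an atom of [a] is also a summand of [b]. It is cancelled from both sides, and the
    dimension of [a] drops. *)
Lemma refinement_mulrIn n (a b : M) : (0 < n)%N -> a *+ n = b *+ n -> a = b.
Proof.
move=> n_gt0; have [d] := ubnP (dim a); elim: d a b => // d IHd a b.
rewrite ltnS => a_d e.
have [a0|/atom_summand[p [a' [p_atom aE]]]] := pselect (a = 0).
  move: e; rewrite a0 mul0rn -(prednK n_gt0) mulrS.
  by move=> /esym/refinement_addr_eq0.
have [||b' bE] := @atom_summand_mulrn p b (a' *+ n + p *+ n.-1) n => //.
  by rewrite -e aE addrCA -mulrS prednK // mulrnDl addrC.
rewrite aE bE; congr (_ + _); apply: IHd.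
  apply: leq_trans a_d; rewrite aE dimD -[ltnLHS]add0n ltn_add2r lt0n.
  by apply/eqP => /dim_eq0; apply: p_atom.1.
apply: (@refinement_addIr _ _ (p *+ n)).
by rewrite -!mulrnDl !(addrC _ p) -aE -bE.
Qed.

End RefinementMonoid.

(** * The centroid of a non-degenerate algebra and the refinement property *)

Section Centroid.
Variable K : fieldType.
Implicit Types A B C D I : alg K.

(** The last clause is the working tool: [b_j] kills every other basis vector, so multiplying by it
    isolates one coordinate. *)
Lemma nondegenerate_coord A : nondegenerate (A := A) fullv ->
  exists b : (adim A).-tuple 'rV[K]_(adim A),
  [/\ basis_of fullv b, {in b &, forall x y, x != y -> amul A x y = 0},
      forall i : 'I_(adim A), amul A b`_i b`_i != 0
    & forall x (j : 'I_(adim A)),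
        amul A x b`_j = coord b j x *: amul A b`_j b`_j].
Proof.
case=> b [b_basis b_nat] b_nd.
have size_b : size b == adim A.
  by apply/eqP; have := size_basis (X := in_tuple b) b_basis; rewrite dimvf /dim /= mul1n.
exists (Tuple size_b); split=> //= [i|x j].
  by rewrite b_nd // mem_nth // (eqP size_b).
have jb : (j < size b)%N by rewrite (eqP size_b).
have {1}-> : x = \sum_i coord (Tuple size_b) i x *: b`_i.
  exact: (coord_basis (b_basis : basis_of _ (Tuple size_b)) (memvf x)).
rewrite linear_sumlz (bigD1 j) //= linearZl_LR big1 ?addr0 // => i ij.
rewrite linearZl_LR b_nat ?scaler0 // ?mem_nth // ?(eqP size_b) //.
rewrite nth_uniq ?(eqP size_b) //.
exact: free_uniq (basis_free b_basis).
Qed.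

Lemma annihilator_eq0 A x : nondegenerate (A := A) fullv ->
  (forall y, amul A x y = 0) -> x = 0.
Proof.
move=> /nondegenerate_coord[b [b_basis _ b_nd bE]] x0.
rewrite (coord_basis b_basis (memvf x)) big1 // => i _.
have /eqP := x0 b`_i; rewrite bE scaler_eq0 (negPf (b_nd i)) orbF.
by move=> /eqP->; rewrite scale0r.
Qed.

(** Membership in the centroid, which contains the projections onto the summands of a direct sum. *)
Definition centroidal A (P : 'M[K]_(adim A)) := forall x y,
  amul A x y *m P = amul A (x *m P) y /\ amul A x y *m P = amul A x (y *m P).

Lemma centroidalM A P Q : centroidal (A := A) P -> centroidal (A := A) Q ->
  centroidal (A := A) (P *m Q).
Proof.
by move=> cP cQ x y; split; rewrite !mulmxA;
  [rewrite (cP _ _).1 (cQ _ _).1|rewrite (cP _ _).2 (cQ _ _).2].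
Qed.

(** In a product of [x] and [y], one operator can be moved onto the first factor and the other onto
    the second, so their order does not matter. Hence [x *m (P *m Q)] and [x *m (Q *m P)] differ by
    an element of the annihilator, which is zero. *)
Lemma centroidalC A P Q : nondegenerate (A := A) fullv ->
  centroidal (A := A) P -> centroidal (A := A) Q -> P *m Q = Q *m P.
Proof.
move=> A_nd cP cQ; apply/row_matrixP => i; rewrite !rowE.
apply/eqP; rewrite -subr_eq0; apply/eqP; apply: (annihilator_eq0 A_nd) => y.
rewrite linearBl /= !mulmxA; set x := delta_mx _ _; apply/eqP; rewrite subr_eq0.
by rewrite -(cQ _ _).1 (cQ _ _).2 -!(cP _ _).1 -(cQ _ _).2 (cQ _ _).1.
Qed.

(** Matrices act on rows from the right: [i] is the inclusion, [p] the projection, and [p *m i] the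
    idempotent of [A] with image [I]. *)
Definition retract I A (i : 'M[K]_(adim I, adim A)) (p : 'M[K]_(adim A, adim I)) :=
  [/\ i *m p = 1%:M,
      forall u v, amul I u v *m i = amul A (u *m i) (v *m i)
    & forall x y, amul A x y *m p = amul I (x *m p) (y *m p)].

Definition image_mul A r (i : 'M[K]_(r, adim A)) (p : 'M[K]_(adim A, r))
  (u v : 'rV[K]_r) := amul A (u *m i) (v *m i) *m p.

Lemma image_mul_bilinear A r (i : 'M[K]_(r, adim A)) (p : 'M[K]_(adim A, r)) :
  bilinear_for *:%R *:%R (image_mul i p).
Proof.
split=> z a u v; rewrite /image_mul mulmxDl -scalemxAl.
  by rewrite linearPl mulmxDl -scalemxAl.
by rewrite linearPr mulmxDl -scalemxAl.
Qed.

(** The central idempotent [p *m i] fixes or kills each member of a natural basis of [A]; the images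
    under [p] of the fixed members form a natural basis of [I]. *)
Lemma retract_nondegenerate I A i p : nondegenerate (A := A) fullv ->
  centroidal (A := A) (p *m i) -> @retract I A i p ->
  nondegenerate (A := I) fullv.
Proof.
move=> /nondegenerate_coord[b [b_basis b_nat b_nd bE]] cP [ip iM pM].
have piE x : x \in b -> x *m p != 0 -> x *m p *m i = x.
  move=> xb xp; have xE : b`_(index x b) = x by rewrite nth_index.
  have xlt : (index x b < adim A)%N by rewrite -[ltnRHS](size_tuple b) index_mem.
  pose k := Ordinal xlt.
  (* For [j != k] the projection of [x] times [b_j] is the projection of [x b_j = 0], so coordinate
     [j] vanishes and only a multiple of [x] is left. *)
  have [c cE] : exists c, x *m p *m i = c *: x.
    exists (coord b k (x *m p *m i)); rewrite {1}(coord_basis b_basis (memvf (_ *m i))).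
    rewrite (bigD1 k) //= big1 ?addr0 ?xE // => j jk.
    have jlt : (j < size b)%N by rewrite size_tuple.
    have : amul A (x *m p *m i) b`_j = 0.
      rewrite -mulmxA -(cP _ _).1 b_nat ?mul0mx ?mem_nth // -xE.
      rewrite nth_uniq ?size_tuple //; first by rewrite eq_sym.
      exact: free_uniq (basis_free b_basis).
    by move=> /eqP; rewrite bE scaler_eq0 (negPf (b_nd j)) orbF => /eqP->; rewrite scale0r.
  (* Applying [p] to both sides and using [i *m p = 1%:M] forces [c = 1]. *)
  have := congr1 (mulmx^~ p) cE; rewrite /= -[x *m p *m i *m p]mulmxA ip mulmx1.
  rewrite -scalemxAl -[LHS]scale1r => /eqP; rewrite -subr_eq0 -scalerBl.
  rewrite scaler_eq0 (negPf xp) orbF subr_eq0 => /eqP c1.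
  by rewrite cE -c1 scale1r.
pose c := [seq x *m p | x <- b & x *m p != 0].
have cP' y : y \in c -> exists2 x, x \in b & [/\ y = x *m p, y *m i = x & y != 0].
  by case/mapP=> x; rewrite mem_filter => /andP[xp xb] ->; exists x; rewrite ?piE.
exists c; last first.
  move=> y /cP'[x xb [yE yi y0]]; apply/eqP => /(congr1 (mulmx^~ i)).
  rewrite /= mul0mx iM yi; apply/eqP.
  move: (b_nd); rewrite -(nth_index 0 xb) => /(_ (Ordinal _)); apply.
  by rewrite -[ltnRHS](size_tuple b) index_mem.
split; last first.
  move=> y y' /cP'[x xb [yE yi y0]] /cP'[x' xb' [yE' yi' y0']] yy'.
  rewrite yE yE' -pM b_nat ?mul0mx //; apply: contraNneq yy' => xx'.
  by rewrite yE yE' xx'.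
rewrite basisEfree subvf dimvf /dim /= mul1n; apply/andP; split.
  (* Freeness: the inclusion [i] carries [c] back to a subfamily of [b]. *)
  have c_free : free [seq x <- b | x *m p != 0].
    by apply: filter_free; apply: basis_free b_basis.
  have cE : [seq x <- b | x *m p != 0] = map (mulmx^~ i) c.
    rewrite -map_comp -[LHS]map_id; apply/eq_in_map => x /=.
    by rewrite mem_filter => /andP[xp xb]; rewrite piE.
  move: c_free; rewrite cE /free size_map => /eqP <-.
  have i_lin : linear (mulmx^~ i : 'rV_(adim I) -> 'rV_(adim A)).
    by move=> a u v; rewrite mulmxDl -scalemxAl.
  pose f := linfun (linear_pack i_lin).
  have -> : map (mulmx^~ i) c = map f c by apply: eq_map => x; rewrite lfunE.
  by rewrite -limg_span limg_dim_eq ?eqxx //; apply/eqP; rewrite -subv0;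
    apply/subvP => u; rewrite memv_cap memv_ker lfunE /= => /andP[_ /eqP ui];
    rewrite memv0 -[u]mulmx1 -ip mulmxA ui mul0mx.
have fullc : (fullv <= <<c>>)%VS.
  apply/subvP => u _; rewrite -[u]mulmx1 -ip mulmxA.
  rewrite (coord_basis b_basis (memvf (u *m i))) mulmx_suml memv_suml // => k _.
  rewrite -scalemxAl memvZ //; have [->|bp] := eqVneq (b`_k *m p) 0; first exact: mem0v.
  by apply/memv_span/map_f; rewrite mem_filter bp mem_nth // size_tuple.
have := dimvS fullc; rewrite dimvf /dim /= mul1n => /leq_trans; apply; exact: dim_span.
Qed.

Lemma image_retract A r (i : 'M[K]_(r, adim A)) (p : 'M[K]_(adim A, r)) :
  i *m p = 1%:M -> centroidal (A := A) (p *m i) ->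
  @retract (Alg (bilinear_pack (image_mul_bilinear i p))) A i p.
Proof.
move=> ip cP; split=> //= [u v|x y]; rewrite /image_mul.
  rewrite -mulmxA (cP _ _).1; congr (amul A _ _).
  by rewrite mulmxA -[u *m i *m p]mulmxA ip mulmx1.
rewrite -[x *m p *m i]mulmxA -[y *m p *m i]mulmxA -(cP _ _).1 -(cP _ _).2.
by rewrite !mulmxA -![_ *m i *m p]mulmxA ip !mulmx1.
Qed.

(** A rank factorisation [P = p *m i] is used; cancelling the full-rank outer factors in
    [P *m P = P] leaves [i *m p = 1%:M]. *)
Lemma centroid_split A P : nondegenerate (A := A) fullv ->
  centroidal (A := A) P -> P *m P = P ->
  exists (I : ndalg K) i p, @retract I A i p /\ p *m i = P.
Proof.
move=> A_nd cP PP; have := mulmx_base P.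
have := row_base_free P; have := col_base_full P.
move: (row_base P) (col_base P) => i p p_full i_free pi.
have {p_full i_free} ip : i *m p = 1%:M.
  apply: (row_free_inj i_free); apply: (row_full_inj p_full).
  by rewrite !mulmxA mulmx1 pi -mulmxA pi PP.
have cpi : centroidal (A := A) (p *m i) by rewrite pi.
pose I : alg K := Alg (bilinear_pack (image_mul_bilinear i p)).
have I_retract : @retract I A i p by apply: image_retract.
by exists (NdAlg (@retract_nondegenerate I A i p A_nd cpi I_retract)), i, p.
Qed.

Lemma orthogonal_split n c d (i : 'M[K]_(c, n)) (p : 'M_(n, c)) (i' : 'M_(d, n)) p' :
  i *m p = 1%:M -> i' *m p' = 1%:M -> (p *m i) *m (p' *m i') = 0 -> i *m p' = 0.
Proof.
move=> ip ip' pp0; have -> : i *m p' = i *m ((p *m i) *m (p' *m i')) *m p'.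
  by rewrite !mulmxA ip mul1mx -mulmxA ip' mulmx1.
by rewrite pp0 mulmx0 mul0mx.
Qed.

(** The isomorphism takes the [C] and [D] components inside [A]; orthogonality makes the cross terms
    [iC *m pD] and [iD *m pC] vanish. *)
Lemma split_dsum A B C D iB pB iC pC iD pD :
  @retract B A iB pB -> @retract C A iC pC -> @retract D A iD pD ->
  pB *m iB = pC *m iC + pD *m iD -> (pC *m iC) *m (pD *m iD) = 0 ->
  (pD *m iD) *m (pC *m iC) = 0 -> alg_iso B (dsum C D).
Proof.
move=> [ipB iMB pMB] [ipC iMC pMC] [ipD iMD pMD] pi_sum CD0 DC0.
have iCpD := orthogonal_split ipC ipD CD0.
have iDpC := orthogonal_split ipD ipC DC0.
have piB (w : 'rV_(adim A)) : w *m pB *m iB = w *m pC *m iC + w *m pD *m iD.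
  by rewrite -!mulmxA pi_sum mulmxDr.
apply: (@alg_isoI _ B (dsum C D)
  (fun u => row_mx (u *m iB *m pC) (u *m iB *m pD))
  (fun w : 'rV_(_ + _) => (lsubmx w *m iC + rsubmx w *m iD) *m pB)).
- by move=> a u v; rewrite !mulmxDl -!scalemxAl scale_row_mx add_row_mx.
- move=> u; rewrite row_mxKl row_mxKr -piB -[u *m iB *m pB]mulmxA.
  by rewrite ipB mulmx1 -mulmxA ipB mulmx1.
- move=> w; rewrite piB -!mulmxA -[LHS]/(row_mx _ _) -[RHS]hsubmxK.
  rewrite !(mulmxA, mulmxDl) -!mulmxA ipC ipD iCpD iDpC !(mulmx0, mulmx1, addr0, add0r).
  by rewrite ipC ipD iCpD iDpC !(mulmx0, mulmx1, addr0, add0r).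
- by move=> u v; rewrite dsum_mulE iMB pMC pMD.
Qed.

(** The blocks of the matrices of the isomorphism and of its inverse serve as projections and
    inclusions. *)
Lemma dsum_retracts A C D : alg_iso A (dsum C D) ->
  exists iC pC iD pD, [/\ @retract C A iC pC, @retract D A iD pD,
    pC *m iC + pD *m iD = 1%:M,
    (pC *m iC) *m (pD *m iD) = 0 & (pD *m iD) *m (pC *m iC) = 0].
Proof.
case/alg_iso_inv=> f [g [fK gK fM gM]].
pose F : 'M_(adim A, adim C + adim D) := lin1_mx f.
pose G : 'M_(adim C + adim D, adim A) := lin1_mx g.
have FE x : x *m F = f x by exact: mul_rV_lin1.
have GE x : x *m G = g x by exact: mul_rV_lin1.
have FG : F *m G = 1%:M.
  by apply/row_matrixP => i; rewrite !rowE mulmxA FE GE fK mulmx1.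
have GF : G *m F = 1%:M.
  by apply/row_matrixP => i; rewrite !rowE mulmxA GE FE gK mulmx1.
have iE (w : 'rV_(adim C + adim D)) : lsubmx w *m usubmx G + rsubmx w *m dsubmx G = g w.
  by rewrite -mul_row_col hsubmxK vsubmxK GE.
have pE x : f x = row_mx (x *m lsubmx F) (x *m rsubmx F).
  by rewrite -mul_mx_row hsubmxK FE.
have := GF; rewrite -[G]vsubmxK -[F]hsubmxK mul_col_row scalar_mx_block.
move=> /eq_block_mx[CC CD DC DD].
have gMul x y : g (amul (dsum C D) x y) = amul A (g x) (g y) := gM x y.
have fMul x y : f (amul A x y) = amul (dsum C D) (f x) (f y) := fM x y.
have mulCE u v : amul C u v *m usubmx G = amul A (u *m usubmx G) (v *m usubmx G).
  have := gMul (row_mx u 0) (row_mx v 0); rewrite dsum_mulE linear0r -!iE.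
  by rewrite !row_mxKl !row_mxKr !mul0mx !addr0.
have mulDE u v : amul D u v *m dsubmx G = amul A (u *m dsubmx G) (v *m dsubmx G).
  have := gMul (row_mx 0 u) (row_mx 0 v); rewrite dsum_mulE linear0r -!iE.
  by rewrite !row_mxKl !row_mxKr !mul0mx !add0r.
exists (usubmx G), (lsubmx F), (dsubmx G), (rsubmx F); split.
- split=> // x y; have := fMul x y; rewrite !pE dsum_mulE.
  by move=> /eq_row_mx[].
- split=> // x y; have := fMul x y; rewrite !pE dsum_mulE.
  by move=> /eq_row_mx[].
- by rewrite -mul_row_col hsubmxK vsubmxK.
- by rewrite mulmxA -[lsubmx F *m _ *m _]mulmxA CD mulmx0 mul0mx.
- by rewrite mulmxA -[rsubmx F *m _ *m _]mulmxA DC mulmx0 mul0mx.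
Qed.

(** An element of [A] is determined by its [C] and [D] components, and products are computed
    componentwise. *)
Lemma retract_centroidal A C D iC pC iD pD :
  @retract C A iC pC -> @retract D A iD pD ->
  pC *m iC + pD *m iD = 1%:M ->
  (pC *m iC) *m (pD *m iD) = 0 -> (pD *m iD) *m (pC *m iC) = 0 ->
  centroidal (A := A) (pC *m iC).
Proof.
move=> [ipC iMC pMC] [ipD iMD pMD] pi_sum CD0 DC0.
have iCpD := orthogonal_split ipC ipD CD0.
have ext (x y : 'rV_(adim A)) : x *m pC = y *m pC -> x *m pD = y *m pD -> x = y.
  by move=> eC eD; rewrite -[x]mulmx1 -[y]mulmx1 -pi_sum !mulmxDr !mulmxA eC eD.
have iCC (x : 'rV_(adim A)) : x *m (pC *m iC) *m pC = x *m pC.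
  by rewrite mulmxA -mulmxA ipC mulmx1.
have iCD (x : 'rV_(adim A)) : x *m (pC *m iC) *m pD = 0.
  by rewrite mulmxA -mulmxA iCpD mulmx0.
by move=> x y; split; apply: ext; rewrite !(pMC, pMD) ?iCC ?iCD ?pMC // ?linear0l ?linear0r.
Qed.

Lemma alg_iso_adim A B : alg_iso A B -> adim A = adim B.
Proof.
case/alg_iso_inv=> f [g [fK gK _ _]].
have FG : lin1_mx f *m lin1_mx g = 1%:M.
  by apply/row_matrixP => i; rewrite !rowE mulmxA !mul_rV_lin1 /= fK mulmx1.
have GF : lin1_mx g *m lin1_mx f = 1%:M.
  by apply/row_matrixP => i; rewrite !rowE mulmxA !mul_rV_lin1 /= gK mulmx1.
by apply/eqP; rewrite eqn_leq (mulmx1_min FG) (mulmx1_min GF).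
Qed.

(** The projections attached to both decompositions lie in the centroid of the total algebra, hence
    commute. The four mixed products are therefore orthogonal idempotents, and their images are the
    common refinement. *)
Lemma dsum_refinement (A B C D : ndalg K) : alg_iso (dsum A B) (dsum C D) ->
  exists P Q R S : ndalg K, [/\ alg_iso A (dsum P Q), alg_iso B (dsum R S),
    alg_iso C (dsum P R) & alg_iso D (dsum Q S)].
Proof.
move=> iso; have E_nd : nondegenerate (A := dsum A B) fullv.
  exact: ndalg_nondegenerate (nd_dsum A B).
case: (dsum_retracts (alg_iso_refl (dsum A B))) => iA [pA [iB [pB [rA rB AB1 AB0 BA0]]]].
case: (dsum_retracts iso) => iC [pC [iD [pD [rC rD CD1 CD0 DC0]]]].
have cA := retract_centroidal rA rB AB1 AB0 BA0.
have cC := retract_centroidal rC rD CD1 CD0 DC0.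
have cB := retract_centroidal rB rA (etrans (addrC _ _) AB1) BA0 AB0.
have cD := retract_centroidal rD rC (etrans (addrC _ _) CD1) DC0 CD0.
have idem I (i : 'M_(adim I, adim (dsum A B))) p :
    @retract I (dsum A B) i p -> p *m i *m (p *m i) = p *m i.
  by case=> ip _ _; rewrite mulmxA -[p *m i *m p]mulmxA ip mulmx1.
have {idem} [iA2 iB2 iC2 iD2] :=
  And4 (idem _ _ _ rA) (idem _ _ _ rB) (idem _ _ _ rC) (idem _ _ _ rD).
(* The projections get opaque names, so that rewriting treats each as a single matrix. *)
have [a aE] : {a | a = pA *m iA} by eexists.
have [b bE] : {b | b = pB *m iB} by eexists.
have [c cE] : {c | c = pC *m iC} by eexists.
have [d dE] : {d | d = pD *m iD} by eexists.
rewrite -?(aE, bE, cE, dE) in cA cB cC cD iA2 iB2 iC2 iD2 AB1 AB0 BA0 CD1 CD0 DC0.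
have split p q : centroidal (A := dsum A B) p -> centroidal (A := dsum A B) q ->
    p *m p = p -> q *m q = q ->
    exists (I : ndalg K) i r, @retract I (dsum A B) i r /\ r *m i = p *m q.
  move=> cp cq pp qq; apply: centroid_split => //; first exact: centroidalM.
  by rewrite mulmxA -[p *m q *m p]mulmxA (centroidalC E_nd cq cp) mulmxA pp -mulmxA qq.
have orth p q p' q' : centroidal (A := dsum A B) q -> centroidal (A := dsum A B) p' ->
    p *m p' = 0 \/ q *m q' = 0 -> p *m q *m (p' *m q') = 0.
  move=> cq cp' e; rewrite mulmxA -[p *m q *m p']mulmxA (centroidalC E_nd cq cp').
  by case: e => e; rewrite ?mulmxA ?e ?mul0mx // -mulmxA e mulmx0.
have [P [iP [pP [rP PE]]]] := split _ _ cA cC iA2 iC2.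
have [Q [iQ [pQ [rQ QE]]]] := split _ _ cA cD iA2 iD2.
have [R [iR [pR [rR RE]]]] := split _ _ cB cC iB2 iC2.
have [S [iS [pS [rS SE]]]] := split _ _ cB cD iB2 iD2.
exists P, Q, R, S; split.
- apply: (split_dsum rA rP rQ); rewrite -?aE PE QE ?orth //; try by [left | right].
  by rewrite -mulmxDr CD1 mulmx1.
- apply: (split_dsum rB rR rS); rewrite -?bE RE SE ?orth //; try by [left | right].
  by rewrite -mulmxDr CD1 mulmx1.
- apply: (split_dsum rC rP rR); rewrite -?cE PE RE ?orth //; try by [left | right].
  by rewrite -mulmxDl AB1 mul1mx.
- apply: (split_dsum rD rQ rS); rewrite -?dE QE SE ?orth //; try by [left | right].
  by rewrite -mulmxDl AB1 mul1mx.
Qed.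

End Centroid.

(** * The monoid of isomorphism classes inside its Grothendieck ring *)

Section Grothendieck.
Variable K : fieldType.

Definition isoclass_dim (x : isoclass K) : nat := adim (repr x).

Lemma isoclass_dimE (X : ndalg K) : isoclass_dim (\pi_(isoclass K) X) = adim X.
Proof. exact/alg_iso_adim/alg_iso_repr. Qed.

Lemma isoclassD (X Y : ndalg K) :
  \pi_(isoclass K) X + \pi_(isoclass K) Y = \pi_(isoclass K) (nd_dsum X Y).
Proof. exact: ic_addE. Qed.

Lemma isoclassM (X Y : ndalg K) :
  \pi_(isoclass K) X * \pi_(isoclass K) Y = \pi_(isoclass K) (nd_tensor X Y).
Proof. exact: ic_mulE. Qed.

Lemma isoclass_dimD (x y : isoclass K) :
  isoclass_dim (x + y) = (isoclass_dim x + isoclass_dim y)%N.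
Proof.
by elim/quotW: x => X; elim/quotW: y => Y; rewrite isoclassD !isoclass_dimE.
Qed.

Lemma isoclass_dim_eq0 (x : isoclass K) : isoclass_dim x = 0%N -> x = 0.
Proof.
elim/quotW: x => -[[n m] A_nd]; rewrite isoclass_dimE /= => n0; subst n.
apply/isoclassP; apply: (@alg_isoI _ (Alg m) (zero_alg K) id id) => // x y.
by rewrite [LHS]thinmx0 [RHS]thinmx0.
Qed.

Lemma isoclass_refine (a b c d : isoclass K) : a + b = c + d ->
  exists p q r s, [/\ a = p + q, b = r + s, c = p + r & d = q + s].
Proof.
elim/quotW: a => A; elim/quotW: b => B; elim/quotW: c => C; elim/quotW: d => D.
rewrite !isoclassD => /isoclassP/dsum_refinement[P [Q [R [S [AE BE CE DE]]]]].
exists (\pi_(isoclass K) P), (\pi_(isoclass K) Q), (\pi_(isoclass K) R), (\pi_(isoclass K) S).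
by rewrite !isoclassD; split; apply/isoclassP.
Qed.

Lemma isoclass_addIr : right_injective (+%R : isoclass K -> _ -> _).
Proof.
move=> y a b; rewrite ![y + _]addrC.
exact: refinement_addIr isoclass_dimD isoclass_dim_eq0 isoclass_refine _ _ _.
Qed.

(** Cancellation removes the auxiliary summand [k] from the equality test of the completion. *)
Lemma completion_in_inj : injective (@completion_in (isoclass K)).
Proof.
move=> a b /completionP[k] /=; rewrite !addr0 ![_ + k]addrC.
exact: isoclass_addIr.
Qed.

Lemma completion_inB (S : comPzSemiRingType) (x : completion S) :
  exists a b, x = completion_in a - completion_in b.
Proof.
elim/quotW: x => -[a b]; exists a, b.
rewrite [- _]cp_oppE [RHS]cp_addE.
by apply/completionP; exists 0; rewrite /= !(addr0, add0r).
Qed.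

Lemma completion_inD (S : comPzSemiRingType) (a b : S) :
  completion_in (a + b) = completion_in a + completion_in b.
Proof.
rewrite [RHS]cp_addE; apply/completionP.
by exists 0; rewrite /= !addr0.
Qed.

Lemma completion_in0 (S : comPzSemiRingType) : completion_in (0 : S) = 0.
Proof. by []. Qed.

Lemma completion_in1 (S : comPzSemiRingType) : completion_in (1 : S) = 1.
Proof. by []. Qed.

Lemma completion_inM (S : comPzSemiRingType) (a b : S) :
  completion_in (a * b) = completion_in a * completion_in b.
Proof.
rewrite [RHS]cp_mulE; apply/completionP.
by exists 0; rewrite /= !(mulr0, mul0r, addr0).
Qed.

Lemma completion_inMn (S : comPzSemiRingType) (a : S) n :
  completion_in (a *+ n) = completion_in a *+ n.
Proof. by elim: n => // n IHn; rewrite !mulrS completion_inD IHn. Qed.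

(** With [x] written as a difference of two classes, torsion becomes an equality of multiples in the
    monoid, where division by [n] is possible. *)
Lemma grothendieck_mulrIn n (x : grothendieck K) :
  (0 < n)%N -> x *+ n = 0 -> x = 0.
Proof.
move=> n_gt0; have [a [b ->]] := completion_inB x.
rewrite mulrnBl -!completion_inMn => /subr0_eq/completion_in_inj e.
have -> : a = b; last by rewrite subrr.
exact: (refinement_mulrIn isoclass_dimD isoclass_dim_eq0 isoclass_refine n_gt0 e).
Qed.

(** * Shift algebras and the square of the class of a cyclic algebra *)

Section ShiftAlgebras.

(* The algebra with natural basis the standard one and e_(s i)^2 = e_i. *)
Definition shift_alg (A : alg K) (s : 'I_(adim A) -> 'I_(adim A)) :=
  forall x y i, amul A x y 0 i = x 0 (s i) * y 0 (s i).

Lemma cyclic_shift n : @shift_alg (cyclic_alg K n) (@ord_pred n).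
Proof.
move=> x y i; rewrite /= /cyclic_mul summxE (bigD1 (ord_pred i)) //=.
rewrite big1 => [|j ji].
  by rewrite !mxE addr0 ord_predK !eqxx mulr1.
rewrite mxE [X in _ * X]mxE eqxx /=; case: eqP => [e|_]; last by rewrite mulr0.
by rewrite e ordSK eqxx in ji.
Qed.

(** A tensor is read as a matrix, on whose two indices the shifts act independently. Both sides are
    bilinear, so pure tensors suffice. *)
Lemma tensor_shift (A B : alg K) s t : @shift_alg A s -> @shift_alg B t ->
  forall x y i j, vec_mx (amul (tensor A B) x y) i j =
    vec_mx x (s i) (t j) * vec_mx y (s i) (t j).
Proof.
move=> sA tB x y i j.
have tE m n (u : 'rV[K]_m) (v : 'rV[K]_n) k l : vec_mx (tens u v) k l = u 0 k * v 0 l.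
  by rewrite /tens mxvecK mxE big_ord1 mxE.
pose f y x := (vec_mx (amul (tensor A B) x y) i j : K^o).
pose g y x := (vec_mx x (s i) (t j) * vec_mx y (s i) (t j) : K^o).
suff fg : f y =1 g y by apply: fg.
apply: tens_ext => [a u v|a u v|u v].
- by rewrite /f linearPl linearP !mxE.
- by rewrite /g linearP !mxE mulrDl -mulrA.
move: y; apply: (@tens_ext _ _ _ K^o (fun y => f y _) (fun y => g y _)) => [a u' v'|a u' v'|u' v'].
- by rewrite /f linearPr linearP !mxE.
- by rewrite /g linearP !mxE mulrDr mulrCA.
by rewrite /f /g tensor_mulE !tE sA tB mulrACA.
Qed.

(** The product algebra [K^n]: a concrete representative of [n] times the unit class. *)
Definition diag_mul n (x y : 'rV[K]_n) : 'rV[K]_n := \row_i (x 0 i * y 0 i).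

Lemma diag_mul_bilinear n : bilinear_for *:%R *:%R (@diag_mul n).
Proof.
split=> z a x y; apply/rowP => i; rewrite !mxE; first by rewrite mulrDl mulrA.
by rewrite mulrDr mulrCA.
Qed.

Definition diag_alg n : alg K := Alg (bilinear_pack (@diag_mul_bilinear n)).

Lemma diag_nondegenerate n : nondegenerate (A := diag_alg n) fullv.
Proof.
apply: (@nondegenerateI _ (diag_alg n) [seq delta_mx 0 i | i <- enum 'I_n]).
- by rewrite size_map size_enum_ord.
- move=> x; rewrite (row_sum_delta x) memv_suml // => i _.
  by rewrite memvZ // memv_span // map_f // mem_enum.
- move=> _ _ /mapP[i _ ->] /mapP[j _ ->] ne.
  have ij : i != j by apply: contraNneq ne => ->.
  apply/rowP => k; rewrite !mxE; case: (eqVneq k i) => [->|_]; last by rewrite mul0r.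
  by rewrite (negPf ij) mulr0.
- move=> _ /mapP[i _ ->]; apply/eqP => /rowP/(_ i)/eqP.
  by rewrite !mxE !eqxx mulr1 oner_eq0.
Qed.

Definition nd_diag n : ndalg K := NdAlg (diag_nondegenerate n).

Lemma nd_diagE n : \pi_(isoclass K) (nd_diag n) = n%:R.
Proof.
elim: n => [|n IHn].
  by apply: isoclass_dim_eq0; rewrite isoclass_dimE.
rewrite mulrS -IHn -[1 in RHS]/(\pi_(isoclass K) (nd_base K)) isoclassD.
apply/isoclassP.
apply: (@alg_isoI _ (diag_alg (1 + n)) (dsum (base_alg K) (diag_alg n)) id id) => // x y.
rewrite /= /dsum_mul -[LHS]hsubmxK; congr row_mx; apply/rowP => i; rewrite !mxE //.
by rewrite ord1.
Qed.

(** The simultaneous shift of [(i, j)] preserves [j - i], and each of the [n] differences carries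
    one copy of [C_n]. So the square is isomorphic to the tensor product of [K^n] and [C_n]. *)
Lemma nd_cyclic_sqr n : (0 < n)%N ->
  let c := \pi_(isoclass K) (nd_cyclic K n) in c * c = c *+ n.
Proof.
case: n => // n _ c; rewrite -mulr_natl -nd_diagE !isoclassM; apply/isoclassP.
apply: alg_iso_sym.
(* Indices form the additive group of integers modulo [n.+1], in which [ord_pred] subtracts one. *)
have pS (i j : 'I_n.+1) : ord_pred j - ord_pred i = j - i :> 'I_n.+1.
  have predE k : ord_pred k = k - inZp 1 :> 'I_n.+1.
    apply/eqP; rewrite eq_sym subr_eq -{1}(ord_predK k).
    by apply/eqP/val_inj; rewrite /= modnDmr addn1.
  by rewrite !predE opprB addrA subrK.
(* The source is indexed by the pair of the difference [j - i] and [i], the target by [(i, j)]. *)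
apply: (@alg_isoI _ (tensor (diag_alg n.+1) (cyclic_alg K n.+1))
  (tensor (cyclic_alg K n.+1) (cyclic_alg K n.+1))
  (fun x : 'rV_(n.+1 * n.+1) => mxvec (\matrix_(i, j) vec_mx x (j - i) i))
  (fun x : 'rV_(n.+1 * n.+1) => mxvec (\matrix_(k, i) vec_mx x i (i + k)))).
- move=> a x y; rewrite -linearP; congr mxvec; apply/matrixP => i j.
  by rewrite linearP !mxE.
- move=> x; rewrite -[RHS]vec_mxK; congr mxvec; apply/matrixP => k i.
  by rewrite mxvecK !mxE addrC addKr.
- move=> x; rewrite -[RHS]vec_mxK; congr mxvec; apply/matrixP => i j.
  by rewrite mxvecK !mxE addrC subrK.
have diagS : @shift_alg (diag_alg n.+1) id by move=> x y i; rewrite mxE.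
move=> x y; rewrite -[RHS]vec_mxK; congr mxvec; apply/matrixP => i j.
rewrite mxE; apply: etrans (tensor_shift diagS (@cyclic_shift _) _ _ _ _) _.
apply: etrans (esym (tensor_shift (@cyclic_shift _) (@cyclic_shift _) _ _ _ _)).
by rewrite !mxvecK !mxE pS.
Qed.

End ShiftAlgebras.

Lemma gclass_cyclic_sum r (n : 'I_r -> nat) :
  gclass (cyclic_sum K n) = \sum_(i < r) gclass (nd_cyclic K (n i)).
Proof.
rewrite /cyclic_sum; elim/big_ind2: _ => [|x X y Y|//].
  by [].
by move=> <- <-; rewrite gclassD.
Qed.

Lemma gclass_cyclic_sqr n : (0 < n)%N ->
  let c := gclass (nd_cyclic K n) in c * c = c *+ n.
Proof.
move=> n_gt0 c; rewrite -completion_inMn -completion_inM.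
by congr completion_in; apply: nd_cyclic_sqr.
Qed.

Lemma nd_cyclic1 : gclass (nd_cyclic K 1) = 1.
Proof.
congr completion_in; apply/isoclassP.
apply: (@alg_isoI _ (cyclic_alg K 1) (base_alg K) id id) => // x y.
by apply/rowP => i; rewrite (@cyclic_shift 1) !mxE [i]ord1 [ord_pred _]ord1.
Qed.

(** Multiplying the relation by [x i] absorbs that term into the constant, which becomes [m + d i];
    by induction [x i * b] is torsion. A multiple of the relation then loses its [x i] term, and
    induction applies again with constant [m]. *)
Lemma quadratic_sum_torsion (R : comPzRingType) (I : Type) (l : seq I)
    (x : I -> R) (d : I -> nat) m (b : R) :
  (forall i, x i * x i = x i *+ d i) -> (0 < m)%N ->
  (m%:R + \sum_(i <- l) x i) * b = 0 -> exists2 N, (0 < N)%N & b *+ N = 0.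
Proof.
move=> xx; elim: l m b => [|i l IHl] m b m_gt0.
  by rewrite big_nil addr0 mulr_natl => b0; exists m.
rewrite big_cons => b0.
have [||N N_gt0 xb0] := IHl (m + d i)%N (x i * b) => //; first by rewrite addn_gt0 m_gt0.
  transitivity (x i * ((m%:R + (x i + \sum_(j <- l) x j)) * b)).
    by rewrite natrD !mulrDl !mulrDr !mulrA xx mulr_natl; ring.
  by rewrite b0 mulr0.
have [||N' N'_gt0 b'0] := IHl m (b *+ N) => //.
  transitivity (((m%:R + (x i + \sum_(j <- l) x j)) * b) *+ N - x i * b *+ N).
    by ring.
  by rewrite b0 xb0 mul0rn subr0.
by exists (N * N')%N; rewrite ?muln_gt0 ?N_gt0 // mulrnA.
Qed.

(** * Characters, and why the annihilating product is nonzero *)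

Section Characters.

Definition characterless (A : alg K) :=
  forall chi : {linear 'rV[K]_(adim A) -> K^o},
  (forall x y, chi (amul A x y) = chi x * chi y) -> forall x, chi x = 0.

Lemma characterless_iso (A B : alg K) :
  alg_iso A B -> characterless A -> characterless B.
Proof.
case=> f [g fK gK] fM A0 chi chiM x; rewrite -(gK x).
apply: (A0 (chi \o f)) => u v /=; rewrite -chiM; congr (chi _); exact: fM.
Qed.

Lemma characterless_dsum (A B : alg K) :
  characterless A -> characterless B -> characterless (dsum A B).
Proof.
move=> A0 B0 chi chiM x.
pose l u := chi (row_mx u 0); pose r v := chi (row_mx 0 v).
have l_lin : linear l.
  by move=> a u v; rewrite /l -linearP scale_row_mx add_row_mx scaler0 addr0.
have r_lin : linear r.
  by move=> a u v; rewrite /r -linearP scale_row_mx add_row_mx scaler0 addr0.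
rewrite -[x]hsubmxK -[lsubmx x]addr0 -[rsubmx x]add0r -add_row_mx linearD /=.
rewrite [X in X + _](A0 (linear_pack l_lin)) ?add0r => [|u v]; last first.
  by rewrite /= /l -chiM dsum_mulE linear0r.
apply: (B0 (linear_pack r_lin)) => u v.
by rewrite /= /r -chiM dsum_mulE linear0r.
Qed.

Lemma ordS_neq n (i : 'I_n) : (1 < n)%N -> i != ordS i.
Proof.
move=> n_gt1; apply/eqP => /(congr1 val) /=.
have := ltn_ord i; rewrite leq_eqVlt => /predU1P[iE|lt_i]; last first.
  by rewrite modn_small // => /n_Sn.
by rewrite iE modnn => i0; rewrite -iE i0 in n_gt1.
Qed.

(** If [chi] takes the value [a] at [c_i (x) v], it takes [a ^+ 2] at [c_(i+1) (x) (v v)]. For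
    [n > 1] these two tensors have product zero, so [a ^+ 3 = 0]. *)
Lemma characterless_cyclic_tensor n (B : alg K) :
  (1 < n)%N -> characterless (tensor (cyclic_alg K n) B).
Proof.
move=> n_gt1 chi chiM.
have chi_delta i v : chi (tens (delta_mx 0 i) v) = 0.
  pose d j : 'rV[K]_n := delta_mx 0 j.
  have sqr : chi (tens (d (ordS i)) (amul B v v)) = chi (tens (d i) v) ^+ 2.
    by rewrite expr2 -chiM tensor_mulE cyclic_mulE eqxx.
  have : chi (tens (d i) v) * chi (tens (d (ordS i)) (amul B v v)) = 0.
    rewrite -chiM tensor_mulE cyclic_mulE (negPf (ordS_neq _ n_gt1)).
    by rewrite -(scale0r 0) tensZl scale0r linear0.
  by rewrite sqr -exprS => /eqP; rewrite expf_eq0 => /andP[_ /eqP].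
apply: (@tens_ext _ _ _ K^o chi (fun=> 0)) => [a x y|a x y|u v].
- by rewrite linearP.
- by rewrite scaler0 addr0.
rewrite (row_sum_delta u) -[tens _ v]/(linear_pack (@tensPl _ _ _ v) _).
rewrite !linear_sum big1 // => i _.
by rewrite linearZ linearZ /= chi_delta scaler0.
Qed.

Lemma base_dsum_character (A : alg K) : ~ characterless (dsum (base_alg K) A).
Proof.
pose chi (x : 'rV[K]_(1 + adim A)) : K^o := lsubmx x 0 0.
have chi_lin : linear chi by move=> a x y; rewrite /chi linearP !mxE.
move=> /(_ (linear_pack chi_lin)) chi0.
have /chi0 : forall x y, chi (amul (dsum (base_alg K) A) x y) = chi x * chi y.
  by move=> x y; rewrite /chi /= /dsum_mul row_mxKl /= /base_mul mxE.
move=> /(_ (row_mx (const_mx 1) 0))/eqP.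
by rewrite /= /chi row_mxKl mxE oner_eq0.
Qed.

Definition class_characterless (x : isoclass K) := characterless (repr x).

Lemma class_characterlessE (X : ndalg K) :
  class_characterless (\pi_(isoclass K) X) <-> characterless X.
Proof.
by split; apply: characterless_iso; [|apply: alg_iso_sym]; apply: alg_iso_repr.
Qed.

Lemma class_characterlessD x y : class_characterless x ->
  class_characterless y -> class_characterless (x + y).
Proof.
elim/quotW: x => X; elim/quotW: y => Y.
rewrite isoclassD !class_characterlessE; exact: characterless_dsum.
Qed.

Lemma class_characterless0 : class_characterless 0.
Proof. by apply/class_characterlessE => chi _ u; rewrite [u]thinmx0 linear0. Qed.

Lemma class_characterlessMn x n : class_characterless x ->
  class_characterless (x *+ n).
Proof.
move=> x0; elim: n => [|n IHn]; last by rewrite mulrS; apply: class_characterlessD.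
exact: class_characterless0.
Qed.

Lemma class_characterless_cyclicM n x : (1 < n)%N ->
  class_characterless (\pi_(isoclass K) (nd_cyclic K n) * x).
Proof.
elim/quotW: x => X n_gt1; rewrite isoclassM class_characterlessE.
exact: characterless_cyclic_tensor.
Qed.

Lemma class_character1D x : ~ class_characterless (1 + x).
Proof.
elim/quotW: x => X; rewrite -[1]/(\pi_(isoclass K) (nd_base K)) isoclassD.
by rewrite class_characterlessE; apply: base_dsum_character.
Qed.

(** The product expands to [m + t - t'] with [m > 0] and [t], [t'] characterless. Were it zero,
    [m + t = t'] would be characterless although it has [K] as a summand. *)
Lemma prod_cyclic_neq0 r (n : 'I_r -> nat) : (forall i, (1 < n i)%N) ->
  \prod_(i < r) ((n i)%:R - gclass (nd_cyclic K (n i))) != 0.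
Proof.
move=> n_gt1; pose c i : isoclass K := \pi_(isoclass K) (nd_cyclic K (n i)).
have [m [t [t' [m_gt0 t0 t'0 ->]]]] : exists m t t', [/\ (0 < m)%N,
    class_characterless t, class_characterless t' &
    \prod_(i < r) ((n i)%:R - gclass (nd_cyclic K (n i))) =
    completion_in (m%:R + t) - completion_in t'].
  elim/big_rec: _ => [|i y _ [m [t [t' [m_gt0 t0 t'0 ->]]]]].
    exists 1%N, 0, 0; split=> //; try exact: class_characterless0.
    by rewrite addr0 completion_in1 completion_in0 subr0.
  (* The expansion of [(n_i - c_i) * (m + t - t')], with terms sorted by sign. *)
  exists (m * n i)%N, (t *+ n i + c i * t'), (t' *+ n i + (c i *+ m + c i * t)); split.
  - by rewrite muln_gt0 m_gt0 ltnW.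
  - by apply: class_characterlessD; [apply: class_characterlessMn|apply: class_characterless_cyclicM].
  - apply: class_characterlessD; first exact: class_characterlessMn.
    apply: class_characterlessD; last exact: class_characterless_cyclicM.
    by rewrite -mulr_natr; apply: class_characterless_cyclicM.
  rewrite -[gclass _]/(completion_in (c i)).
  rewrite !(completion_inD, completion_inM, completion_inMn, completion_in1).
  by rewrite natrM; ring.
rewrite subr_eq0; apply/eqP => /completion_in_inj e.
apply: (@class_character1D (m.-1%:R + t)).
by rewrite addrA -[1]/(1%:R) -natrD add1n prednK // e.
Qed.

End Characters.

Lemma cyclic_sum_zero_divisor r (n : 'I_r -> nat) : (forall i, (0 < n i)%N) ->
  zero_divisor (gclass (cyclic_sum K n)) <-> forall i, (1 < n i)%N.
Proof.
move=> n_gt0; rewrite gclass_cyclic_sum; split=> [[b b0 xb0] j|n_gt1].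
  rewrite ltn_neqAle n_gt0 andbT; apply: contra_neq b0 => /= nj.
  (* The summand [C_1] contributes [1], so [b] is killed by [1] plus a sum of quadratic elements; it
     is torsion, hence zero. *)
  rewrite (bigD1 j) //= -nj nd_cyclic1 -big_filter in xb0.
  have [|N N_gt0] := @quadratic_sum_torsion (grothendieck K) _
    _ (fun i => gclass (nd_cyclic K (n i))) n 1 b _ isT xb0.
    by move=> i; apply: gclass_cyclic_sqr.
  exact: grothendieck_mulrIn.
(* The factor of index [i] kills the [i]-th summand, since [c_n (n - c_n) = 0]. *)
exists (\prod_(i < r) ((n i)%:R - gclass (nd_cyclic K (n i)))).
  exact: prod_cyclic_neq0.
rewrite mulr_suml big1 // => i _; rewrite (bigD1 i) //= mulrA mulrBr.
by rewrite gclass_cyclic_sqr // mulr_natr subrr mul0r.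
Qed.

End Grothendieck.

(** * Balance of a directed cycle and of a graph with a loop *)

Section CycleGraph.
Variables (m : nat) (E : rel 'I_m) (g : 'I_m -> 'I_m) (v0 : 'I_m).
Hypotheses (g_inj : injective g) (EE : forall k l, E k l = (l == g k)).
Hypothesis g_conn : forall l, fconnect g v0 l.

Let L := order g v0.
(** A potential: it grows by one along every edge, except the one closing the cycle, where it falls
    from [L - 1] to [0]. *)
Let h l : int := Posz (findex g v0 l).

Lemma findex_step l : (L %| h (g l) - h l - 1)%Z.
Proof.
have lt_h : (findex g v0 l < L)%N by apply: findex_max.
have gE : g l = iter (findex g v0 l).+1 g v0 by rewrite iterS iter_findex.
rewrite /h; move: lt_h; rewrite leq_eqVlt => /predU1P[hL|lt_h].
  rewrite {1}gE hL iter_order // findex0 -hL sub0r -opprD rpredN.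
  by rewrite -PoszD addn1.
by rewrite gE findex_iter // intS addrK subrr dvdz0.
Qed.

(** Modulo [L] each step, forwards or backwards, changes the potential by its own contribution to
    the balance; the sum telescopes. *)
Lemma path_balance_findex v p : is_path E v p ->
  (L %| path_balance p - (h (last v [seq x.2 | x <- p]) - h v))%Z.
Proof.
elim: p v => [|[d w] p IHp] v /=.
  by rewrite /path_balance big_nil subrr subr0 dvdz0.
move=> [Evw /IHp]; rewrite /path_balance big_cons /=.
set B := \sum_(x <- p) _; set l := last _ _ => dvdB.
have dvd_step : (L %| (if d then 1 else -1) - (h w - h v))%Z.
  case: d Evw; rewrite EE => /eqP ->; last first.
    have -> : -1 - (h w - h (g w)) = h (g w) - h w - 1 by ring.
    exact: findex_step.
  have -> : 1 - (h (g v) - h v) = - (h (g v) - h v - 1) by ring.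
  by rewrite rpredN; apply: findex_step.
have -> : (if d then 1 else -1) + B - (h l - h v) =
    ((if d then 1 else -1) - (h w - h v)) + (B - (h l - h w)) by ring.
exact: rpredD.
Qed.

Lemma cycle_graph_balance : g v0 != v0 -> (1 < graph_balance E)%N.
Proof.
move=> gv0.
have [dvd_all dvd_max] : is_gcd_set _ (graph_balance E) := gcd_setP _.
have L_gt1 : (1 < L)%N.
  rewrite ltn_neqAle order_gt0 andbT; apply: contraNneq gv0 => L1.
  by rewrite -[X in _ == X](iter_order g_inj) -/L -L1.
have L_dvd : (L %| graph_balance E)%N.
  apply: dvd_max => _ [v [p [[p_path p_last] ->]]].
  by have := path_balance_findex p_path; rewrite p_last subrr subr0.
(* One full turn has balance [L]. This excludes the value [0], which every [L] divides. *)
have dvd_L : (graph_balance E %| L)%N.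
  apply: dvd_all; exists v0, [seq (true, w) | w <- traject g (g v0) L]; split.
    split; last by rewrite -map_comp map_id last_traject iter_order.
    have : forall k v, is_path E v [seq (true, w) | w <- traject g (g v) k]; last exact.
    by elim=> //= k IHk v; split; [rewrite EE|exact: IHk].
  rewrite /path_balance big_map (eq_bigr (fun=> 1)) // big_const_seq count_predT.
  by rewrite size_traject iter_addr_0 natz.
exact: leq_trans L_gt1 (dvdn_leq (dvdn_gt0 (ltnW L_gt1) dvd_L) L_dvd).
Qed.

End CycleGraph.

Lemma loop_graph_balance m (E : rel 'I_m) v : E v v -> ~~ (1 < graph_balance E)%N.
Proof.
move=> Evv; rewrite -leqNgt; apply: dvdn_leq => //.
apply: (gcd_setP _).1; exists v, [:: (true, v)]; split=> //.
by rewrite /path_balance big_seq1.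
Qed.

(** * Direct summands of an algebra whose basis is permuted by squaring *)

Section ShiftSummands.
Variables (K : fieldType) (A : alg K) (s t : 'I_(adim A) -> 'I_(adim A)).
Hypotheses (stK : cancel s t) (tsK : cancel t s) (sA : shift_alg s).
Local Notation e i := (delta_mx 0 i : 'rV[K]_(adim A)).
Implicit Types (S T O : {set 'I_(adim A)}) (U V : {vspace 'rV[K]_(adim A)}).

Lemma delta_neq0 n (i : 'I_n) : (delta_mx 0 i : 'rV[K]_n) != 0.
Proof. by apply/eqP => /rowP/(_ i)/eqP; rewrite !mxE !eqxx oner_eq0. Qed.

Lemma delta_rowE n (i j : 'I_n) : (delta_mx 0 i : 'rV[K]_n) 0 j = (j == i)%:R.
Proof. by rewrite mxE eqxx. Qed.

Lemma row_delta (x : 'rV[K]_(adim A)) i :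
  (forall j, j != i -> x 0 j = 0) -> x = x 0 i *: e i.
Proof.
move=> x0; apply/rowP => j; rewrite mxE delta_rowE.
by case: eqVneq => [->|/x0 ->]; rewrite ?mulr1 ?mulr0.
Qed.

(** Coordinates are pulled back along [s], so basis vectors are pushed forward along its inverse
    [t]. *)
Lemma shift_mulr x j : amul A x (e j) = x 0 j *: e (t j).
Proof.
apply/rowP => k; rewrite sA [RHS]mxE !delta_rowE.
by rewrite (can2_eq stK tsK); case: eqVneq => [->|_]; rewrite ?tsK // !mulr0.
Qed.

Definition coord_seq T := [seq e i | i <- enum 'I_(adim A) & i \in T].

Definition coord_space T := <<coord_seq T>>%VS.

Lemma mem_coord_seq T x : x \in coord_seq T -> exists2 i, i \in T & x = e i.
Proof. by case/mapP=> i; rewrite mem_filter => /andP[iT _] ->; exists i. Qed.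

Lemma delta_coord_space T i : i \in T -> e i \in coord_space T.
Proof. by move=> iT; apply/memv_span/map_f; rewrite mem_filter iT mem_enum. Qed.

Lemma coord_spaceP T (x : 'rV[K]_(adim A)) :
  reflect (forall j, j \notin T -> x 0 j = 0) (x \in coord_space T).
Proof.
apply: (iffP idP) => [xT j jT|x0].
  rewrite (coord_span (X := in_tuple (coord_seq T)) xT) summxE big1 // => i _.
  have [k kT /= ->] := mem_coord_seq (mem_nth 0 (ltn_ord i)).
  rewrite mxE delta_rowE; case: eqVneq jT => [->|_ _]; last by rewrite mulr0.
  by rewrite kT.
rewrite (row_sum_delta x) memv_suml // => i _.
have [iT|/x0 ->] := boolP (i \in T); last by rewrite scale0r mem0v.
by rewrite memvZ ?delta_coord_space.
Qed.

Lemma coord_seq_natural T : natural_basis (coord_space T) (coord_seq T).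
Proof.
split.
  rewrite /basis_of eqxx; apply: (@catl_free _ _ (coord_seq (~: T))).
  have full_free : free [seq e i | i <- enum 'I_(adim A)].
    apply: basis_free (_ : basis_of fullv _); rewrite basisEdim dimvf /dim /= mul1n.
    rewrite size_map size_enum_ord leqnn andbT; apply/subvP => x _.
    rewrite (row_sum_delta x) memv_suml // => i _.
    by rewrite memvZ // memv_span // map_f // mem_enum.
  rewrite -map_cat (perm_free (_ : perm_eq _ [seq e i | i <- enum 'I_(adim A)])) //.
  apply: perm_map; rewrite (eq_filter (a1 := mem (~: T)) (a2 := predC (mem T))).
    by rewrite perm_filterC.
  by move=> i; rewrite !inE.
move=> _ _ /mem_coord_seq[i iT ->] /mem_coord_seq[j jT ->] ij.
rewrite shift_mulr delta_rowE; case: (eqVneq j i) ij => [->|_ _].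
  by rewrite eqxx.
by rewrite scale0r.
Qed.

Lemma size_coord_seq T : size (coord_seq T) = #|T|.
Proof. by rewrite size_map cardE {2}/enum_mem -enumT. Qed.

Lemma coord_ideal S T : T \subset S -> (forall i, i \in T -> t i \in T) ->
  ideal_of (coord_space S) (coord_space T).
Proof.
move=> /subsetP TS Tt; split.
  apply/subvP => x /coord_spaceP x0; apply/coord_spaceP => j jS.
  by apply: x0; apply: contraNN jS; apply: TS.
have Ts j : j \notin T -> s j \notin T by apply: contraNN => /Tt; rewrite stK.
by move=> a x _ /coord_spaceP x0; split; apply/coord_spaceP => j /Ts/x0 sj;
  rewrite sA sj ?mulr0 ?mul0r.
Qed.

Lemma coord_decomposition S T : T \subset S -> (forall i, i \in T -> t i \in T) ->
  (forall i, i \in S :\: T -> t i \in S :\: T) ->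
  evolution_decomposition (coord_space S) (coord_space T) (coord_space (S :\: T)).
Proof.
move=> TS Tt STt; have /subsetP TS' := TS; split.
- exact: coord_ideal.
- by apply: coord_ideal => //; apply: subsetDl.
- by eexists; apply: coord_seq_natural.
- by eexists; apply: coord_seq_natural.
split; last first.
  apply/eqP; rewrite -subv0; apply/subvP => x; rewrite memv_cap memv0.
  case/andP=> /coord_spaceP xT /coord_spaceP xST; apply/eqP/rowP => j; rewrite mxE.
  by have [jT|/xT//] := boolP (j \in T); apply: xST; rewrite inE jT.
apply/eqP; rewrite eqEsubv; apply/andP; split.
  rewrite subv_add; apply/andP; split; apply/subvP => x /coord_spaceP x0;
    apply/coord_spaceP => j jS; apply: x0.
    by apply: contraNN jS => /TS'.
  by apply: contraNN jS; rewrite inE => /andP[].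
apply/subvP => x /coord_spaceP x0; rewrite (row_sum_delta x) memv_suml // => j _.
have [jS|/x0 ->] := boolP (j \in S); last by rewrite scale0r mem0v.
apply: memvZ; have [jT|jT] := boolP (j \in T).
  by rewrite -[e j]addr0 memv_add ?mem0v ?delta_coord_space.
by rewrite -[e j]add0r memv_add ?mem0v ?delta_coord_space // inE jT.
Qed.

(** Each standard basis vector lies wholly in [U] or wholly in the complement [V], so [U] is spanned
    by the basis vectors it contains. *)
Lemma direct_summand_coord U : direct_summand U ->
  exists2 S, U = coord_space S & forall i, i \in S -> t i \in S.
Proof.
case=> V [[_ U_ideal] [_ V_ideal] _ _ [UV1 UV0]].
have mul0 u v : u \in U -> v \in V -> amul A u v = 0.
  move=> uU vV; apply/eqP; rewrite -memv0 -UV0 memv_cap.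
  by rewrite (U_ideal _ _ (memvf v) uU).2 (V_ideal _ _ (memvf u) vV).1.
have coord0 x j : e j \in V -> x \in U -> x 0 j = 0.
  move=> jV /mul0/(_ jV)/eqP; rewrite shift_mulr scaler_eq0 (negPf (delta_neq0 _)).
  by rewrite orbF => /eqP.
have UorV j : e j \in U \/ e j \in V.
  have /memv_addP[u uU [v vV uv]] : e j \in (U + V)%VS by rewrite UV1 memvf.
  have uE : u = u 0 j *: e j.
    (* As [e_j e_i = 0], the products of [u] and [v] with [e_i] are opposite, hence lie in both
       ideals and vanish; this kills coordinate [i] of [u]. *)
    apply: row_delta => i ij; have : amul A u (e i) \in (U :&: V)%VS.
      rewrite memv_cap (U_ideal _ _ (memvf (e i)) uU).2 /=.
      have -> : u = e j - v by rewrite uv addrK.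
      rewrite linearBl /= shift_mulr delta_rowE (negPf ij) scale0r sub0r.
      by rewrite memvN (V_ideal _ _ (memvf (e i)) vV).2.
    rewrite UV0 memv0 shift_mulr scaler_eq0 (negPf (delta_neq0 _)) orbF.
    by move=> /eqP.
  have [uj0|uj0] := eqVneq (u 0 j) 0.
    by right; rewrite uv uE uj0 scale0r add0r.
  by left; rewrite -[e j]scale1r -(mulVf uj0) -scalerA -uE memvZ.
exists [set j | e j \in U] => [|i]; last first.
  rewrite !inE => iU; have := (U_ideal _ _ (memvf (e i)) iU).1.
  by rewrite shift_mulr delta_rowE eqxx scale1r.
apply/eqP; rewrite eqEsubv; apply/andP; split; apply/subvP => x.
  move=> xU; apply/coord_spaceP => j; rewrite inE => jU.
  by apply: coord0 xU; case: (UorV j) jU => // ->.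
move=> /coord_spaceP x0; rewrite (row_sum_delta x) memv_suml // => j _.
have [|/x0 ->] := boolP (j \in [set j | e j \in U]); last by rewrite scale0r mem0v.
by rewrite inE => jU; rewrite memvZ.
Qed.

(** Members of [b] have disjoint nonempty supports inside [S], and there are as many of them as
    elements of [S]; hence every support is a single point. *)
Lemma natural_basis_coord S b : natural_basis (coord_space S) b ->
  exists tau : 'I_(size b) -> 'I_(adim A), [/\ injective tau,
    forall i, i \in S <-> exists k, i = tau k
  & forall k : 'I_(size b), exists2 c : K, c != 0 & b`_k = c *: e (tau k)].
Proof.
case=> b_basis b_nat; have b_free := basis_free b_basis.
have bk0 (k : 'I_(size b)) : b`_k != 0 by apply: (free_not0 b_free); rewrite mem_nth.
(* Coordinate [t i] of the product of [b_k] and [b_l] is the product of their coordinates at [i]. *)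
have disj (k l : 'I_(size b)) i : b`_k 0 i != 0 -> b`_l 0 i != 0 -> k = l.
  move=> bki bli; apply/val_inj/eqP; rewrite -(nth_uniq 0 (ltn_ord k) (ltn_ord l) (free_uniq b_free)).
  apply: contraNT bki => kl; have := b_nat _ _ (mem_nth 0 _) (mem_nth 0 _) kl.
  move=> /(_ (ltn_ord k) (ltn_ord l))/rowP/(_ (t i))/eqP.
  by rewrite sA tsK mxE mulf_eq0 (negPf bli) orbF.
pose tau (k : 'I_(size b)) := xchoose (rV0Pn _ (bk0 k)).
have tauP (k : 'I_(size b)) : b`_k 0 (tau k) != 0 by exact: (xchooseP (rV0Pn _ (bk0 k))).
have tau_inj : injective tau.
  by move=> k l kl; apply: disj (tauP k) _; rewrite kl.
have tauS k : tau k \in S.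
  apply: contraNT (tauP k) => kS; apply/eqP; apply: (coord_spaceP S b`_k _ _ kS).
  by apply: (basis_mem b_basis); rewrite mem_nth.
have size_b : size b = #|S|.
  rewrite -size_coord_seq.
  have := size_basis (X := in_tuple b) b_basis => <-.
  exact: (size_basis (X := in_tuple (coord_seq S)) (coord_seq_natural S).1).
have im_tau : [set tau k | k in 'I_(size b)] = S.
  apply/eqP; rewrite eqEcard card_imset // card_ord -size_b leqnn andbT.
  by apply/subsetP => _ /imsetP[k _ ->].
have SP i : i \in S <-> exists k, i = tau k.
  by rewrite -im_tau; split=> [/imsetP[k _ ->]|[k ->]]; [exists k|apply: imset_f].
exists tau; split=> // k; exists (b`_k 0 (tau k)) => //.
(* A further support point [i] of [b_k] would be [tau l] for some [l], and disjointness gives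
   [l = k]. *)
apply: row_delta => i ik; apply/eqP; apply: contraNT ik => bki.
have [l iE] : exists l, i = tau l.
  apply/SP; apply: contraNT bki => iS; apply/eqP; apply: (coord_spaceP S b`_k _ _ iS).
  by apply: (basis_mem b_basis); rewrite mem_nth.
by rewrite iE (disj l k i) // iE.
Qed.

(** The basis chosen inside [balance] is natural as soon as some natural basis exists. *)
Lemma balanceE U : evolution U ->
  exists2 b, natural_basis U b & balance U = graph_balance (@Gamma _ A b).
Proof.
case=> b0 b0_nat; rewrite /balance; set b := classical_sets.xget _ _.
by exists b => //; rewrite /b; case: classical_sets.xgetP => [? -> //|/(_ b0)].
Qed.

(** The line through the fixed basis vector is a summand, indecomposable by dimension, and its graph
    has a loop. *)
Lemma fixpoint_summand i : t i = i -> exists U : {vspace 'rV[K]_(adim A)},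
  [/\ direct_summand U, indecomposable U & ~~ (1 < balance U)%N].
Proof.
move=> ti; have dim1 : \dim (coord_space [set i]) = 1%N.
  have := size_basis (X := in_tuple (coord_seq [set i])) (coord_seq_natural [set i]).1.
  by rewrite size_coord_seq cards1.
exists (coord_space [set i]); split.
- exists (coord_space ([set: _] :\: [set i])).
  have -> : fullv = coord_space [set: _].
    by apply/vspaceP => x; rewrite memvf; apply/esym/coord_spaceP => j; rewrite inE.
  apply: coord_decomposition => [|j|j]; rewrite ?subsetT // !inE.
    by move=> /eqP ->; rewrite ti.
  by rewrite !andbT; apply: contra_neq => tj; rewrite -[j]tsK tj -{1}ti tsK.
- split; first by move=> U0; rewrite U0 dimv0 in dim1.
  case=> V [W [V0 W0 [_ _ _ _ [VW1 VW0]]]].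
  have := dimv_sum_cap V W; rewrite VW1 VW0 dim1 dimv0 addn0.
  move: V0 W0 => /eqP; rewrite -dimv_eq0 -lt0n => V0 /eqP; rewrite -dimv_eq0 -lt0n => W0.
  by lia.
have [b b_nat ->] := balanceE (ex_intro _ _ (coord_seq_natural [set i])).
have [tau [tau_inj SP bE]] := natural_basis_coord b_nat.
have [k kE] : exists k, i = tau k by apply/SP; rewrite inE.
apply: (@loop_graph_balance _ _ k); have [c c0 bk] := bE k; rewrite /Gamma.
have -> : amul A b`_k b`_k = c *: b`_k.
  rewrite {2}bk linearZr_LR /= shift_mulr -kE ti; congr (_ *: _).
  by rewrite bk mxE delta_rowE -kE eqxx mulr1.
by rewrite linearZ /= (coord_free (X := in_tuple b)) ?(basis_free b_nat.1) // eqxx mulr1.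
Qed.

(** The graph is that of the permutation [g] which [t] induces on the indices of [b].
    Indecomposability makes it a single cycle, and the absence of fixed points makes its length
    exceed one. *)
Lemma balance_gt1 U : (forall i, t i != i) -> direct_summand U ->
  indecomposable U -> (1 < balance U)%N.
Proof.
move=> t_neq U_summand [U0 U_indec].
have [_ [_ _ /balanceE[b b_nat ->] _ _]] := U_summand.
have [S US St] := direct_summand_coord U_summand; rewrite US in b_nat U0 U_indec.
have [tau [tau_inj SP bE]] := natural_basis_coord b_nat.
have tauS k : tau k \in S by apply/SP; exists k.
have step k : exists l, t (tau k) == tau l.
  by have /SP[l ->] := St _ (tauS k); exists l.
pose g k := xchoose (step k).
have gE k : tau (g k) = t (tau k) by rewrite (eqP (xchooseP (step k))).
have g_inj : injective g.
  by move=> k l /(congr1 tau); rewrite !gE => /(can_inj tsK)/tau_inj.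
have b_free := basis_free b_nat.1.
have GammaE k l : Gamma (A := A) (b := b) k l = (l == g k).
  have [c c0 bk] := bE k; have [d d0 bgk] := bE (g k).
  (* Rescaling by [c] and [d] changes only the weight [c ^+ 2 / d] of the edge, which stays
     nonzero. *)
  rewrite /Gamma; have -> : amul A b`_k b`_k = (c ^+ 2 / d) *: b`_(g k).
    rewrite {2}bk linearZr_LR /= shift_mulr bk mxE delta_rowE eqxx mulr1 scalerA.
    by rewrite bgk scalerA -mulrA mulVf // mulr1 gE expr2.
  rewrite linearZ /= (coord_free (X := in_tuple b)) // [l == _]eq_sym.
  case: (eqVneq (g k) l) => _; last by rewrite mulr0 eqxx.
  by rewrite mulr1 mulf_neq0 ?expf_neq0 ?invr_eq0.
have [v0 _|k0] := pickP (fun _ : 'I_(size b) => true).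
  have g_conn l : fconnect g v0 l.
    (* If [l] were outside the orbit of [v0], that orbit and its complement in [S] would decompose
       [U]. *)
    pose O := [set tau k | k in fconnect g v0].
    have tauO k : (tau k \in O) = fconnect g v0 k by rewrite mem_imset.
    have OS : O \subset S by apply/subsetP => _ /imsetP[k _ ->].
    apply/negPn/negP => l_nconn; apply: U_indec.
    exists (coord_space O), (coord_space (S :\: O)); split.
    - have : e (tau v0) \in coord_space O by rewrite delta_coord_space // tauO connect0.
      move=> + O0; rewrite O0 memv0; apply/negP; exact: delta_neq0.
    - have : e (tau l) \in coord_space (S :\: O).
        by rewrite delta_coord_space // inE tauO l_nconn tauS.
      move=> + O0; rewrite O0 memv0; apply/negP; exact: delta_neq0.
    apply: coord_decomposition => // i.
      case/imsetP=> k kO ->; rewrite -gE tauO; apply: connect_trans kO _.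
      exact: fconnect1.
    case/setDP=> /SP[k ->]; rewrite tauO => kO.
    by rewrite inE -gE tauO tauS andbT -same_fconnect1_r.
  apply: (cycle_graph_balance g_inj GammaE g_conn).
  by apply: contra_neq (t_neq (tau v0)) => gv0; rewrite -gE gv0.
(* With an empty basis [U] would be zero. *)
case: U0; apply/vspaceP => x; rewrite memv0; apply/coord_spaceP/eqP => [x0|->].
  apply/rowP => j; rewrite mxE x0 //; apply/negP => /SP[k _].
  by have := k0 k.
by move=> j _; rewrite mxE.
Qed.

End ShiftSummands.

(** * Sums of cyclic algebras as shift algebras, and the equivalences *)

(** Squaring permutes the basis block by block, and the block of [C_(n i)] is a single cycle, so
    fixed points come from blocks of length one. *)
Lemma cyclic_sum_shift (K : fieldType) (I : Type) (n : I -> nat) (l : seq I) :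
  let A := \big[@nd_dsum K/nd_zero K]_(i <- l) nd_cyclic K (n i) in
  exists s t : 'I_(adim A) -> 'I_(adim A), [/\ cancel s t, cancel t s,
    @shift_alg K A s & (exists k, t k = k) <-> has (fun i => n i == 1%N) l].
Proof.
elim: l => [|i l [s [t [stK tsK sA fix_t]]]] /=.
  rewrite big_nil; exists id, id; split=> //; last by split=> // -[[]].
  by move=> x y [].
rewrite big_cons; move: (\big[_/_]_(i <- l) _) s t stK tsK sA fix_t => A s t stK tsK sA fix_t.
pose f (u : 'I_(n i) -> 'I_(n i)) (v : 'I_(adim A) -> 'I_(adim A)) (k : 'I_(n i + adim A)) :=
  match split k with inl a => lshift _ (u a) | inr b => rshift _ (v b) end.
have fl u v a : f u v (lshift _ a) = lshift _ (u a) by rewrite /f (unsplitK (inl a)).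
have fr u v b : f u v (rshift _ b) = rshift _ (v b) by rewrite /f (unsplitK (inr b)).
exists (f (@ord_pred _) s), (f (@ordS _) t); split.
- by move=> k; case: (split_ordP k) => j ->; rewrite !(fl, fr) ?ord_predK ?stK.
- by move=> k; case: (split_ordP k) => j ->; rewrite !(fl, fr) ?ordSK ?tsK.
- move=> x y k; rewrite /= /dsum_mul; case: (split_ordP k) => j ->.
    by rewrite row_mxEl cyclic_shift fl !mxE.
  by rewrite row_mxEr sA fr !mxE.
split=> [[k]|/orP[/eqP ni1|/fix_t[k tk]]].
- case: (split_ordP k) => j ->; rewrite !(fl, fr).
    move=> /lshift_inj tj; apply/orP; left.
    (* The index [j] shows that [n i] is positive, and a fixed point of [ordS] excludes
       [1 < n i]. *)
    rewrite eqn_leq (leq_trans _ (ltn_ord j)) // andbT leqNgt.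
    by apply/negP => /(ordS_neq j); rewrite tj eqxx.
  by move=> /rshift_inj tj; apply/orP; right; apply/fix_t; exists j.
- have i_gt0 : (0 < n i)%N by rewrite ni1.
  exists (lshift _ (Ordinal i_gt0)); rewrite fl; congr lshift; apply: val_inj => /=.
  by rewrite ni1.
- by exists (rshift _ k); rewrite fr tk.
Qed.

Theorem theorem13p7 (K : fieldType) (r : nat) (n : 'I_r -> nat)
    (n_gt0 : forall i, (0 < n i)%N) :
  let X := cyclic_sum K n in
  (zero_divisor (gclass X) <-> forall i, (1 < n i)%N) /\
  (zero_divisor (gclass X) <->
     forall U : {vspace 'rV[K]_(adim X)},
       direct_summand U -> indecomposable U -> (1 < balance U)%N).
Proof.
move=> X; have XP := cyclic_sum_zero_divisor K n_gt0; split=> //.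
apply: iff_trans XP _.
have [s [t [stK tsK sX fix_t]]] := cyclic_sum_shift K n (index_enum 'I_r).
split=> [n_gt1 U|balance_X i].
  apply: (balance_gt1 stK tsK sX) => k; apply/eqP => tk.
  have /hasP[i _ /eqP ni1] : has (fun i => n i == 1%N) (index_enum 'I_r).
    by apply/fix_t; exists k.
  by have := n_gt1 i; rewrite ni1.
rewrite ltn_neqAle n_gt0 andbT; apply/eqP => ni1.
(* A summand [C_1] yields a fixed index, whose line is an indecomposable summand of balance at most
   one. *)
have [|k tk] := fix_t.2.
  by apply/hasP; exists i; rewrite ?mem_index_enum // -ni1.
have [U [U_summand U_indec /negP[]]] := fixpoint_summand stK tsK sX tk.
exact: balance_X.
Qed.
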